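(* For every $d\ge1$ there exists a probability measure $\mu_\infty$ on the product space $\mathbb R^{I_d}$ (with the product $\sigma$-algebra), $I_d=\mathrm{Corner}(d)\times[0,1]^d$, such that for every finite $A\subset I_d$ the marginal of $\mu_\infty$ on $\mathbb R^A$ is the centered Gaussian measure with covariance matrix $(K_d(j,l))_{j,l\in A}$, where for $j=(c,x)$ and $l=(c',x')$ $$K_d(j,l)=P_0\bigl(\mathrm{cornerLe}(c,x)\cap\mathrm{cornerLe}(c',x')\bigr)-F^{c}(x)\,F^{c'}(x').$$
   Context: $P_0$ is the uniform (Lebesgue) probability measure on $[0,1]^d$. $\mathrm{Corner}(d)$ is the set of all $2^d$ functions $c:\{0,\dots,d-1\}\to\{\mathrm{true},\mathrm{false}\}$. For $c\in\mathrm{Corner}(d)$ and $x\in[0,1]^d$, $\mathrm{cornerLe}(c,x)=\{s\in[0,1]^d:\ \text{for all }k,\ s_k\ge x_k\text{ if }c(k)=\mathrm{true},\ s_k\le x_k\text{ if }c(k)=\mathrm{false}\}$, and $F^c(x)=\prod_{k=0}^{d-1}g_k(x)$ with $g_k(x)=1-x_k$ if $c(k)=\mathrm{true}$ and $g_k(x)=x_k$ otherwise. Gaussian measures may be degenerate. *)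

(* Defs.v *)
From HB Require Import structures.
From mathcomp Require Import all_boot all_order all_algebra.
From mathcomp Require Import finmap.
From mathcomp Require Import all_classical all_reals all_analysis.

Set Implicit Arguments.
Unset Strict Implicit.
Unset Printing Implicit Defensive.
Import Order.TTheory GRing.Theory Num.Theory.
Import numFieldNormedType.Exports.
Local Open Scope classical_set_scope.
Local Open Scope ring_scope.

Definition coord_cylinders (R : realType) (I : Type) : set (set (I -> R)) :=
  [set C | exists (i : I) (B : set R), measurable B /\ C = [set f | B (f i)]].

(* This is the type [I -> R]; only its canonical sigma-algebra is added. *)
Notation prodR R I := (g_sigma_algebraType (@coord_cylinders R I)).

Section product_space.
Context {R : realType}.

Definition coord (I : Type) (i : I) (f : prodR R I) : R := f i.

Lemma measurable_coord (I : Type) (i : I) : measurable_fun setT (@coord I i).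
Proof.
move=> _ B mB; rewrite setTI; apply: sub_sigma_algebra.
by exists i, B.
Qed.

Definition reindex (I J : Type) (h : J -> I) (f : prodR R I) : prodR R J :=
  fun j => f (h j).

Lemma measurable_reindex (I J : Type) (h : J -> I) :
  measurable_fun setT (reindex h).
Proof.
apply: (@measurability _ _ (prodR R I) (prodR R J) setT (reindex h)
  (@coord_cylinders R J) erefl).
move=> _ [_ [j [B [mB ->]]] <-]; rewrite setTI.
apply: sub_sigma_algebra.
by exists (h j), B.
Qed.

HB.instance Definition _ (I J : Type) (h : J -> I) :=
  isMeasurableFun.Build _ _ _ _ (reindex h) (measurable_reindex h).

Definition marginal (I : choiceType) (mu : probability (prodR R I) R)
    (A : {fset I}) : probability (prodR R A) R :=
  distribution mu (reindex (fun a : A => val a)).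

End product_space.

Section gaussian.
Context {R : realType}.

(* [normal_prob m 0] has the junk value "uniform law on [0, 1]", whereas the
   normal law with standard deviation 0 is the Dirac mass at its mean. *)
Definition normal_law (m s : R) : set R -> \bar R :=
  if s == 0 then dirac m else normal_prob m s.

Definition linform (T : finType) (t : T -> R) (x : prodR R T) : R :=
  \sum_(i : T) t i * x i.

(* Every linear functional has a one-dimensional normal law, possibly a Dirac
   mass; the covariance matrix may thus be singular. *)
Definition is_gaussian (T : finType) (P : probability (prodR R T) R) : Prop :=
  forall t : T -> R, exists (m s : R), 0 <= s /\
    forall B : set R, measurable B ->
      pushforward P (linform t) B = normal_law m s B.

Definition is_centered_gaussian (T : finType) (P : probability (prodR R T) R)
    (K : T -> T -> R) : Prop :=
  [/\ is_gaussian P,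
      forall i : T, ('E_P[coord i] = 0)%E &
      forall i j : T, covariance P (coord i) (coord j) = (K i j)%:E].

End gaussian.

Section product_probability.
Local Open Scope ereal_scope.
Context d1 d2 (T1 : measurableType d1) (T2 : measurableType d2) (R : realType).
Variables (P1 : probability T1 R) (P2 : probability T2 R).

Definition prod_prob : set (T1 * T2) -> \bar R := P1 \x P2.

HB.instance Definition _ := Measure.on prod_prob.

Let prod_prob_setT : prod_prob setT = 1.
Proof.
rewrite /prod_prob -setXTT product_measure1E// -[RHS]mule1.
by congr (_ * _); exact: probability_setT.
Qed.

HB.instance Definition _ :=
  Measure_isProbability.Build _ _ _ prod_prob prod_prob_setT.

End product_probability.

Section uniform_cube.
Context {R : realType}.

Definition tcons (n : nat) (p : measurableTypeR R * n.-tuple R) : n.+1.-tuple R :=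
  [tuple of p.1 :: p.2].

Lemma measurable_tcons (n : nat) : measurable_fun setT (@tcons n).
Proof. exact: measurable_cons. Qed.

HB.instance Definition _ (n : nat) :=
  isMeasurableFun.Build _ _ _ _ (@tcons n) (@measurable_tcons n).

Definition cube (d : nat) : set (d.-tuple R) :=
  [set x | forall k : 'I_d, 0 <= tnth x k <= 1].

Definition uniform01 : probability (measurableTypeR R) R :=
  uniform_prob (@ltr01 R).

(* The d-fold product of the uniform law on [0, 1], seen as a probability on
   R^d carried by the cube. *)
Fixpoint P0 (d : nat) : probability (d.-tuple R) R :=
  match d with
  | 0%N => dirac [tuple]
  | n.+1 => distribution (prod_prob uniform01 (P0 n)) (@tcons n)
  end.

End uniform_cube.
Arguments cube : clear implicits.
Arguments P0 : clear implicits.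

Definition Corner (d : nat) := {ffun 'I_d -> bool}.

Section kernel.
Context {R : realType} {d : nat}.

Definition cornerLe (c : Corner d) (x : d.-tuple R) : set (d.-tuple R) :=
  [set s | cube R d s /\
    forall k : 'I_d, if c k then tnth x k <= tnth s k else tnth s k <= tnth x k].

Definition cornerF (c : Corner d) (x : d.-tuple R) : R :=
  \prod_(k < d) (if c k then 1 - tnth x k else tnth x k).

End kernel.

Definition Idx (R : realType) (d : nat) : choiceType := (Corner d * cube R d)%type.

Definition Kd (R : realType) (d : nat) (j l : Idx R d) : R :=
  fine (P0 R d (cornerLe j.1 (val j.2) `&` cornerLe l.1 (val l.2)))
  - cornerF j.1 (val j.2) * cornerF l.1 (val l.2).

(* Main.v *)
(** No extension theorem is used: the process is built on a single probability
    space.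

    [Kd] is positive semidefinite, being a Schur complement in the Gram matrix
    of the corner events, and the pseudo-metric it defines on the index set is
    separable. Taking successive Schur complements along a dense sequence
    (Gram-Schmidt without a Hilbert space) writes [Kd i j] as the series
    [sum_m v i m * v j m]. If the [g m] are independent standard normal
    variables, [X i = sum_m v i m * g m] (an almost sure limit along a
    subsequence depending on [i]) has the required finite-dimensional laws,
    and the measure is the law of [w |-> (i |-> X i w)].

    The [g m] live on the space of binary sequences with fair independent
    digits: splitting a sequence into its even and odd digits preserves the
    measure onto the product, so iterating the split yields infinitely many
    independent uniform variables, turned into normal ones by the quantile
    function. *)

Require Import Defs.
From HB Require Import structures.
From mathcomp Require Import all_boot all_order all_algebra.
From mathcomp Require Import finmap.
From mathcomp Require Import all_classical all_reals all_analysis.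
From mathcomp Require Import measurable_realfun.
From mathcomp Require Import ring lra.

Set Implicit Arguments.
Unset Strict Implicit.
Unset Printing Implicit Defensive.
Import Order.TTheory GRing.Theory Num.Theory.
Import numFieldNormedType.Exports.
Local Open Scope classical_set_scope.
Local Open Scope ring_scope.

(** Everything is reduced to one-dimensional laws. The goal concerns linear forms, means and
    covariances, and the last two are determined by the laws of the coordinates and of their
    pairwise sums. So the joint law of the [g m] is never described: it suffices that each finite
    combination has law [gauss c], with [c ^+ 2] the sum of the squared coefficients, and the
    even-odd split gives this one variable at a time, by convolving two normal laws.

    Degenerate variances cannot be avoided (the diagonal of [Kd] vanishes at corner sets of
    probability 0 or 1), and densities do not cover them. Hence [gauss s], the image of one fixed
    normal law under a dilation, which varies weakly continuously with [s], [0] included.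

    The index set is uncountable, so almost sure convergence cannot be asked of all indices at once.
    Each [X i] has its own subsequence and null set. A finite-dimensional law meets only finitely
    many of them, and the mixed terms of its variance, cut at the smaller of two ranks, still tend
    to the kernel. The subsequence makes the [L^1] norms of the increments summable, whence almost
    sure convergence by Tonelli. *)

Definition mfun_of d d' (T : measurableType d) (T' : measurableType d')
    (f : T -> T') (mf : measurable_fun setT f) : {mfun T >-> T'} :=
  HB.pack f (isMeasurableFun.Build _ _ _ _ f mf).

Definition image_measure d d' (T : measurableType d) (T' : measurableType d')
    (R : realType) (m : {measure set T -> \bar R}) (f : T -> T')
    (mf : measurable_fun setT f) : {measure set T' -> \bar R} :=
  measure_function_pushforward__canonical__measure_function_Measure m mf.

Lemma measurable_preim d d' (T : measurableType d) (T' : measurableType d')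
    (f : T -> T') (A : set T') :
  measurable_fun setT f -> measurable A -> measurable (f @^-1` A).
Proof. by move=> mf mA; rewrite -[X in measurable X]setTI; exact: mf. Qed.

(** * Normal laws on the line *)

Section normal.
Context {R : realType}.
Local Notation mu := (@lebesgue_measure R).

Lemma measurable_affine (a c : R) :
  measurable_fun setT (fun x : R => a * x + c).
Proof. by apply: measurable_funD => //; exact: measurable_funM. Qed.

Lemma affine_preimage_itvoc (a c u v : R) : 0 < a ->
  (fun x => a * x + c) @^-1` `]u, v] = `](u - c) / a, (v - c) / a]%classic.
Proof.
move=> a0; apply/seteqP; split => x /=; rewrite !in_itv/=;
  by rewrite ltr_pdivrMr// ler_pdivlMr// ltrBlDr lerBrDr (mulrC x).
Qed.

(** Uniqueness of Lebesgue measure: [a] times its pushforward under the affine map has the right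
    value on half-open intervals. *)
Lemma lebesgue_measure_affine (a c : R) (A : set R) : 0 < a -> measurable A ->
  mu A = (a%:E * mu ((fun x => a * x + c)%R @^-1` A))%E.
Proof.
move=> a0 mA; pose f := (fun x : measurableTypeR R => a * x + c : measurableTypeR R).
have mf : measurable_fun setT f := measurable_affine a c.
pose a' : {nonneg R} := NngNum (ltW a0).
have := @lebesgue_measure_unique R (mscale a' (image_measure mu mf)).
move=> -> // _ [[u v]] _ <-.
pose J : set R := `](u - c) / a, (v - c) / a]%classic.
transitivity (a%:E * mu J)%E; last by rewrite /J -affine_preimage_itvoc.
rewrite !lebesgue_measure_itv/=.
rewrite !lte_fin ltr_pM2r ?invr_gt0// ltrD2r.
case: ifPn => _; last by rewrite mule0.
by rewrite -!EFinB -EFinM; congr EFin; field; lra.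
Qed.

Lemma ge0_integral_affine (a c : R) (f : R -> \bar R) : 0 < a ->
  measurable_fun setT f -> (forall x, 0 <= f x)%E ->
  (\int[mu]_x f x = a%:E * \int[mu]_x f (a * x + c)%R)%E.
Proof.
move=> a0 mf f0.
pose g := (fun x : measurableTypeR R => a * x + c : measurableTypeR R).
have mg : measurable_fun setT g := measurable_affine a c.
pose nu : {measure set (measurableTypeR R) -> \bar R} :=
  image_measure mu mg.
pose a' : {nonneg R} := NngNum (ltW a0).
transitivity (\int[mscale a' nu]_x f x)%E.
  by apply: eq_measure_integral => A mA _; exact: (lebesgue_measure_affine c a0 mA).
rewrite ge0_integral_mscale//=.
by rewrite (ge0_integral_pushforward mg)// preimage_setT.
Qed.

(** Change of variables is available for the Radon-Nikodym derivative, which equals [normal_pdf]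
    almost everywhere because both have the same integral over every measurable set. *)
Lemma ge0_integral_normal (m s : R) (f : R -> \bar R) :
  measurable_fun setT f -> (forall x, 0 <= f x)%E ->
  (\int[normal_prob m s]_x f x = \int[mu]_x (f x * (normal_pdf m s x)%:E))%E.
Proof.
move=> mf f0.
have dom := normal_prob_dominates m s.
rewrite -(Radon_Nikodym_SigmaFinite.change_of_variables dom)//.
apply: ge0_ae_eq_integral => //.
- apply: emeasurable_funM => //.
  exact: measurable_int (Radon_Nikodym_SigmaFinite.f_integrable dom).
- apply: emeasurable_funM => //; apply/measurable_EFinP.
  exact: measurable_normal_pdf.
- by move=> x _; rewrite mule_ge0// Radon_Nikodym_SigmaFinite.f_ge0.
- by move=> x _; rewrite mule_ge0// lee_fin normal_pdf_ge0.
- apply: ae_eqe_mul2l; apply: integral_ae_eq => //.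
  + exact: Radon_Nikodym_SigmaFinite.f_integrable.
  + apply/measurable_EFinP; exact: measurable_normal_pdf.
  + by move=> A _ mA; rewrite -Radon_Nikodym_SigmaFinite.f_integral.
Qed.

End normal.

(** * Sums of two independent centered normal variables *)

Section normal_convolution.
Context {R : realType}.
Local Notation mu := (@lebesgue_measure R).

Lemma normal_peakE (s : R) : 0 < s -> normal_peak s = (s * Num.sqrt (pi *+ 2))^-1.
Proof.
move=> s0; rewrite /normal_peak -mulrnAr sqrtrM ?sqr_ge0//.
by rewrite sqrtr_sqr gtr0_norm.
Qed.

Lemma normal_pdf_scale (s x : R) : 0 < s ->
  s * normal_pdf 0 s (s * x) = normal_pdf 0 1 x.
Proof.
move=> s0; rewrite !normal_pdfE ?oner_neq0 ?gt_eqF// !normal_peakE//.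
have q0 : Num.sqrt (pi *+ 2 : R) != 0 by rewrite gt_eqF// sqrtr_gt0 pmulrn_lgt0// pi_gt0.
rewrite mulrA; congr (_ * _).
  by field; rewrite q0 gt_eqF.
rewrite /normal_fun; congr expR; field.
by rewrite gt_eqF.
Qed.

Lemma normal_prob_indic (m s : R) (B : set R) : measurable B ->
  normal_prob m s B = (\int[mu]_x ((\1_B x)%:E * (normal_pdf m s x)%:E))%E.
Proof.
move=> mB; rewrite /normal_prob integral_mkcond/=; apply: eq_integral => x _.
by rewrite patchE indicE; case: ifP; rewrite ?mul1e ?mul0e.
Qed.

Lemma measurable_fun_indic_normal_pdf (m s : R) (B : set R) : measurable B ->
  measurable_fun setT (fun x => (\1_B x)%:E * (normal_pdf m s x)%:E)%E.
Proof.
move=> mB; apply: emeasurable_funM; apply/measurable_EFinP.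
  exact: measurable_indic.
exact: measurable_normal_pdf.
Qed.

Lemma normal_prob_scale (s : R) (B : set R) : 0 < s -> measurable B ->
  normal_prob 0 s B = normal_prob 0 1 ((fun z => s * z) @^-1` B).
Proof.
move=> s0 mB.
have mB' : measurable ((fun z => s * z) @^-1` B).
  by rewrite -[X in measurable X]setTI; exact: measurable_funM.
rewrite (normal_prob_indic 0 s mB) (normal_prob_indic 0 1 mB').
rewrite [LHS](ge0_integral_affine 0 s0); last 2 first.
- exact: measurable_fun_indic_normal_pdf.
- by move=> x; rewrite mule_ge0// lee_fin ?normal_pdf_ge0.
rewrite -ge0_integralZl_EFin//; last 3 first.
- by move=> x _; rewrite mule_ge0// lee_fin normal_pdf_ge0.
- apply: (@measurableT_comp _ _ _ _ _ _ (fun x => (\1_B x)%:E * (normal_pdf 0 s x)%:E)%E).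
    exact: measurable_fun_indic_normal_pdf.
  exact: measurable_affine.
- exact: ltW.
apply: eq_integral => x _; rewrite addr0 muleCA -EFinM normal_pdf_scale//.
Qed.

(** Completing the square in [x]. Probabilistically, the joint density of a summand and the sum is
    the density of the sum at [y] times the conditional density of the summand, normal with mean
    [y * a ^+ 2 / c ^+ 2] and standard deviation [a * b / c]. *)
Lemma normal_pdf_convol (a b c x y : R) : 0 < a -> 0 < b -> 0 < c ->
  c ^+ 2 = a ^+ 2 + b ^+ 2 ->
  normal_pdf 0 b (y - x) * normal_pdf 0 a x =
  normal_pdf 0 c y * normal_pdf (y * a ^+ 2 / c ^+ 2) (a * b / c) x.
Proof.
move=> a0 b0 c0 cE.
have q0 : Num.sqrt (pi *+ 2 : R) != 0 by rewrite gt_eqF// sqrtr_gt0 pmulrn_lgt0// pi_gt0.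
have s0 : 0 < a * b / c by rewrite divr_gt0// mulr_gt0.
rewrite !normal_pdfE ?gt_eqF// !normal_peakE// mulrACA [RHS]mulrACA.
congr (_ * _).
  by field; rewrite q0 !gt_eqF.
rewrite /normal_fun -!expRD; congr expR; rewrite !mulNr.
have -> : (x - y * a ^+ 2 / c ^+ 2) ^+ 2 / ((a * b / c) ^+ 2 *+ 2) =
  (x * (a ^+ 2 + b ^+ 2) - y * a ^+ 2) ^+ 2 / (c ^+ 2 * (a * b) ^+ 2 *+ 2).
  by rewrite -cE; field; rewrite !gt_eqF.
have -> : (y - 0) ^+ 2 / (c ^+ 2 *+ 2) = y ^+ 2 * (a * b) ^+ 2/ (c ^+ 2 * (a * b) ^+ 2 *+ 2).
  by field; rewrite !gt_eqF.
rewrite -!opprD; congr (- _).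
rewrite -mulrDl cE; field.
by rewrite -cE !gt_eqF// exprn_gt0.
Qed.

(** Tonelli, then [normal_pdf_convol]: the conditional density of the first summand integrates to 1
    and leaves the density of the sum. *)
Lemma normal_convolution (a b c : R) (B : set R) : 0 < a -> 0 < b -> 0 < c ->
  c ^+ 2 = a ^+ 2 + b ^+ 2 -> measurable B ->
  (normal_prob 0 a \x normal_prob 0 b)%E [set p | B (p.1 + p.2)] =
  normal_prob 0 c B.
Proof.
move=> a0 b0 c0 cE mB.
have mC : measurable [set p : R * R | B (p.1 + p.2)].
  rewrite -[X in measurable X]setTI.
  by apply: (measurable_funD (@measurable_fst _ _ R R) (@measurable_snd _ _ R R)).
rewrite /product_measure1 ge0_integral_normal//; last first.
  exact: measurable_fun_xsection.
(* Joint density of the first summand [p.1] and the sum [p.2], cut down to sums in [B]. *)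
pose F (p : R * R) : \bar R :=
  ((\1_B p.2)%:E * (normal_pdf 0 b (p.2 - p.1) * normal_pdf 0 a p.1)%:E)%E.
have mF : measurable_fun setT F.
  apply: emeasurable_funM; apply/measurable_EFinP.
    exact: measurableT_comp (measurable_indic _) measurable_snd.
  apply: measurable_funM.
    apply: measurableT_comp; first exact: measurable_normal_pdf.
    exact: measurable_funB.
  exact: measurableT_comp (measurable_normal_pdf _ _) measurable_fst.
have F0 p : (0 <= F p)%E.
  by rewrite /F mule_ge0// lee_fin// mulr_ge0// normal_pdf_ge0.
transitivity (\int[mu]_x \int[mu]_y F (x, y))%E.
  apply: eq_integral => x _ /=.
  (* The translation by [x] is written with slope [1] to match [ge0_integral_affine]; it turns the
     second summand into the sum. *)
  rewrite xsectionE (_ : (fun y => (x, y)) @^-1` _ = (fun y => 1 * y + x) @^-1` B); last first.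
    by apply/seteqP; split => y /=; rewrite mul1r addrC.
  have mB' : measurable ((fun y => 1 * y + x) @^-1` B).
    by rewrite -[X in measurable X]setTI; exact: measurable_affine.
  rewrite normal_prob_indic// /F/=.
  rewrite [RHS](ge0_integral_affine x (@ltr01 R)); last 2 first.
  - exact: (measurableT_comp mF (pair1_measurable x)).
  - by move=> y; exact: (F0 (x, y)).
  rewrite mul1e -ge0_integralZr//; last 3 first.
  - exact: measurable_fun_indic_normal_pdf.
  - by move=> y _; rewrite mule_ge0// lee_fin normal_pdf_ge0.
  - by rewrite lee_fin normal_pdf_ge0.
  apply: eq_integral => y _ /=; rewrite EFinM muleA mul1r addrK.
  have -> : \1_((fun z => 1 * z + x) @^-1` B) y = \1_B (y + x) :> R => [|//].
    by rewrite !indicE -{2}(mul1r y); congr (nat_of_bool _)%:R;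
    apply/idP/idP => /set_mem ?; exact/mem_set.
transitivity (\int[mu]_y \int[mu]_x F (x, y))%E; first exact: fubini_tonelli.
rewrite normal_prob_indic//.
apply: eq_integral => y _.
rewrite /F/=.
under eq_integral do rewrite (normal_pdf_convol _ _ a0 b0 c0 cE) EFinM muleA.
rewrite ge0_integralZl//.
- by rewrite integral_normal_pdf mule1.
- by apply/measurable_EFinP; exact: measurable_normal_pdf.
- by move=> x _; rewrite lee_fin normal_pdf_ge0.
- by rewrite mule_ge0// lee_fin ?normal_pdf_ge0.
Qed.

End normal_convolution.

(** * Second moment and symmetry of the standard normal law *)

Section normal_moments.
Context {R : realType}.
Local Notation mu := (@lebesgue_measure R).
Local Notation phi := (@normal_pdf R 0 1).

Lemma normal_pdf01E (x : R) : phi x = normal_peak 1 * expR (- x ^+ 2 / 2).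
Proof.
by rewrite normal_pdfE ?oner_neq0// /normal_fun subr0 expr1n.
Qed.

Lemma is_derive_normal_pdf (x : R) : is_derive x 1 phi (- (x * phi x)).
Proof.
have -> : phi = (fun y => normal_peak 1 * expR (- y ^+ 2 / 2)).
  by apply/funext => y; exact: normal_pdf01E.
have D1 : is_derive x 1 (fun y : R => - y ^+ 2 / 2) (- x).
  have D2 : is_derive x 1 (fun y : R => y ^+ 2) (2 * x).
    by apply: is_derive_eq; rewrite /GRing.scale/=; lra.
  have -> : (fun y : R => - y ^+ 2 / 2) = (- 2^-1) \*: (fun y : R => y ^+ 2).
    by apply/funext => y /=; rewrite /GRing.scale/= mulNr mulrC mulNr.
  by apply: is_derive_eq; rewrite /GRing.scale/=; lra.
have D3 : is_derive x 1 (expR \o (fun y : R => - y ^+ 2 / 2)) (- x * expR (- x ^+ 2 / 2)).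
  by apply: is_derive_eq; rewrite mulrC.
have -> : (fun y => normal_peak 1 * expR (- y ^+ 2 / 2)) =
    normal_peak 1 \*: (expR \o (fun y : R => - y ^+ 2 / 2)) by [].
by apply: is_derive_eq; rewrite /GRing.scale/=; ring.
Qed.

(** Follows from [1 + x ^+ 2 / 2 <= expR (x ^+ 2 / 2)]; it makes the boundary term of the
    integration by parts vanish at infinity. *)
Lemma normal_pdf_tail (x : R) : 0 < x -> x * phi x <= normal_peak 1 * (2 / x).
Proof.
move=> x0; rewrite normal_pdf01E mulrCA ler_wpM2l// ?normal_peak_ge0//.
rewrite mulNr expRN ler_pdivlMr// mulrAC ler_pdivrMr ?expR_gt0//.
apply: (@le_trans _ _ (2 * (1 + x ^+ 2 / 2))); first nra.
by rewrite ler_pM2l// expR_ge1Dx.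
Qed.

(** Integration by parts of [x] against [x * phi x], a primitive of which is [- phi]. The bound
    [n.+1] keeps the interval nondegenerate at [n = 0]. *)
Lemma integral_sqr_normal_pdf_itv (n : nat) :
  (\int[mu]_(x in `[(- n.+1%:R)%R, n.+1%:R%R]) (x ^+ 2 * phi x)%:E =
   (- 2 * (n.+1%:R * phi n.+1%:R))%:E +
   \int[mu]_(x in `[(- n.+1%:R)%R, n.+1%:R%R]) (phi x)%:E)%E.
Proof.
have phiD x : derivable phi x 1 by case: (is_derive_normal_pdf x).
have cphi : continuous phi by apply: continuous_normal_pdf; exact: oner_neq0.
have nn : - n.+1%:R < n.+1%:R :> R by rewrite ltrNl -subr_gt0 opprK -mulr2n mulrn_wgt0.
have cN : continuous (fun x => - phi x : R) by move=> x; apply: cvgN; exact: cphi.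
transitivity (\int[mu]_(x in `[(- n.+1%:R)%R, n.+1%:R%R]) (id x * (x * phi x))%:E)%E.
  by apply: eq_integral => x _; rewrite mulrA.
rewrite (@integration_by_parts R id (fun x => - phi x) (cst 1) (fun x => x * phi x))//.
- transitivity ((- 2 * (n.+1%:R * phi n.+1%:R))%:E -
    \int[mu]_(x in `[(- n.+1%:R)%R, n.+1%:R%R]) (- (phi x)%:E))%E.
    congr (_ - _)%E; last by apply: eq_integral => x _; rewrite mul1r.
    congr EFin; have -> : phi (- n.+1%:R) = phi n.+1%:R.
      by rewrite !normal_pdf01E sqrrN.
    by rewrite /=; ring.
  by rewrite integral_ge0N ?oppeK// => x _; rewrite lee_fin normal_pdf_ge0.
- by apply: continuous_subspaceT => x; exact: cvg_cst.
- split => [x _|/=|/=]; first exact: derivable_id.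
    by apply: cvg_at_right_filter; exact: cvg_id.
  by apply: cvg_at_left_filter; exact: cvg_id.
- by move=> x _; rewrite derive1E derive_id.
- by apply: continuous_subspaceT => x; apply: cvgM; [exact: cvg_id|exact: cphi].
- split => [x _|/=|/=]; first exact: derivableN.
    by apply: cvg_at_right_filter; exact: cN.
  by apply: cvg_at_left_filter; exact: cN.
- move=> x _; rewrite derive1E deriveN//.
  by have /(@derive_val _ _ _ _ _) -> := is_derive_normal_pdf x; rewrite opprK.
Qed.

Let I (n : nat) : set R := `[- n.+1%:R, n.+1%:R]%classic.

Let bigcup_I : \bigcup_n I n = setT.
Proof.
rewrite -subTset => x _; exists (Num.truncn `|x|) => //; rewrite /I/= in_itv/=.
by rewrite -ler_norml ltW// truncnS_gt.
Qed.

Let cvg_integral_I (f : R -> R) : measurable_fun setT f -> (forall x, 0 <= f x) ->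
  (\int[mu]_(x in I n) (f x)%:E)%E @[n --> \oo] --> (\int[mu]_x (f x)%:E)%E.
Proof.
move=> mf f0; rewrite -bigcup_I; apply: ge0_nondecreasing_set_cvg_integral => //.
- apply/nondecreasing_seqP => n; rewrite subsetEset => x; rewrite /I/= !in_itv/=.
  rewrite -!ler_norml => /le_trans; apply; by rewrite ler_nat.
- by move=> n; exact: measurable_itv.
- by move=> n; apply/measurable_EFinP; exact: measurable_funTS.
- by move=> n x _; rewrite lee_fin.
Qed.

Lemma measurable_sqr_normal_pdf : measurable_fun setT (fun x : R => x ^+ 2 * phi x).
Proof. by apply: measurable_funM => //; exact: measurable_normal_pdf. Qed.

Lemma integral_sqr_normal : (\int[normal_prob 0 1]_x (x ^+ 2)%:E = 1 :> \bar R)%E.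
Proof.
rewrite ge0_integral_normal; last 2 first.
- by apply/measurable_EFinP.
- by move=> x; rewrite lee_fin sqr_ge0.
under eq_integral do rewrite -EFinM.
have := cvg_integral_I measurable_sqr_normal_pdf
  (fun x => mulr_ge0 (sqr_ge0 x) (normal_pdf_ge0 0 1 x)).
rewrite (_ : (fun n => _) = (fun n => (- 2 * (n.+1%:R * phi n.+1%:R))%:E +
   \int[mu]_(x in I n) (phi x)%:E)%E); last first.
  by apply/funext => n; rewrite integral_sqr_normal_pdf_itv.
move=> cvg1.
have cvg2 : ((- 2 * (n.+1%:R * phi n.+1%:R))%:E +
   \int[mu]_(x in I n) (phi x)%:E)%E @[n --> \oo] --> (0%:E + \int[mu]_x (phi x)%:E)%E.
  apply: cvgeD.
  - by rewrite fin_num_adde_defr.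
  - apply: cvg_EFin; first by apply: nearW.
    rewrite -[X in _ --> X](mulr0 (-2)); apply: cvgMr.
    apply: (@squeeze_cvgr _ _ _ _ (fun=> 0) (fun n => normal_peak 1 * (2 * (n.+1%:R)^-1))).
    + apply: nearW => n; rewrite normal_pdf_tail ?ltr0n// andbT.
      by rewrite mulr_ge0// normal_pdf_ge0.
    + exact: cvg_cst.
    + rewrite -[X in _ --> X](mulr0 (normal_peak 1)); apply: cvgMr.
      by rewrite -[X in _ --> X](mulr0 2); apply: cvgMr; exact: cvg_harmonic.
  - apply: cvg_integral_I; first exact: measurable_normal_pdf.
    by move=> x; exact: normal_pdf_ge0.
by rewrite (cvg_unique _ cvg1 cvg2)// add0e integral_normal_pdf.
Qed.

Lemma normal_prob_sym (B : set R) : measurable B ->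
  normal_prob 0 1 ((fun z => - z) @^-1` B) = normal_prob 0 1 B.
Proof.
move=> mB.
have mN : measurable_fun setT (-%R : measurableTypeR R -> measurableTypeR R).
  exact: measurable_funN.
have mB' : measurable ((fun z => - z) @^-1` B).
  by rewrite -[X in measurable X]setTI; exact: mN.
rewrite (normal_prob_indic 0 1 mB) (normal_prob_indic 0 1 mB').
pose nu : {measure set (measurableTypeR R) -> \bar R} :=
  image_measure mu mN.
transitivity (\int[nu]_x ((\1_B x)%:E * (phi x)%:E))%E; last first.
  by apply: eq_measure_integral => A mA _; exact: lebesgue_measureN.
rewrite (ge0_integral_pushforward mN); last 3 first.
- exact: measurableT.
- exact: measurable_fun_indic_normal_pdf.
- by move=> x _; rewrite mule_ge0// lee_fin normal_pdf_ge0.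
rewrite preimage_setT; apply: eq_integral => x _ /=.
have -> : \1_((fun z => - z) @^-1` B) x = \1_B (- x) :> R.
  by rewrite !indicE; congr (nat_of_bool _)%:R;
    apply/idP/idP => /set_mem ?; exact/mem_set.
by rewrite !normal_pdf01E sqrrN.
Qed.

End normal_moments.

(** * Independent bits *)

Section probability_rays.
Context {R : realType}.

(** The generating pi-system used is that of open right rays; complements bring it back to the
    closed left rays on which distribution functions are defined. *)
Lemma probability_eq_rays (P Q : probability (measurableTypeR R) R) :
  (forall x : R, P `]-oo, x]%classic = Q `]-oo, x]%classic) ->
  forall A : set R, measurable A -> P A = Q A.
Proof.
move=> PQ A mA.
pose g (n : nat) : set R := `]- n%:R, +oo[%classic.
apply: (@measure_unique _ R (measurableTypeR R) (@RGenOInfty.G R) g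
  (@RGenOInfty.measurableE R) _ _ _ P Q) => //.
- move=> _ _ [x ->] [y ->]; exists (Num.max x y).
  apply/seteqP; split => z /=; rewrite !in_itv/= !andbT gt_max; first by case=> -> ->.
  by move/andP.
- by move=> n; exists (- n%:R).
- rewrite -subTset => x _; exists (Num.truncn `|x|).+1 => //=.
  rewrite /g/= in_itv/= andbT ltrNl (le_lt_trans (ler_norm _))// normrN.
  exact: truncnS_gt.
- move=> _ [x ->].
  pose I : set (measurableTypeR R) := `]-oo, x]%classic.
  have -> : `]x, +oo[%classic = ~` I by rewrite /I setCitvl.
  have mI : measurable I by exact: measurable_itv.
  transitivity (1 - P I)%E; first exact: probability_setC.
  by rewrite /I PQ; apply/esym; exact: probability_setC.
- move=> n; apply: (@le_lt_trans _ _ 1%E); last exact: ltry.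
  by apply: probability_le1; exact: measurable_itv.
Qed.

End probability_rays.

(** * Independence checked on pi-systems *)

Section pushforward_independence.
Context {R : realType}.

(** With [D] fixed, both sides are finite measures in [A] that agree on a pi-system. The factor is a
    bare constant [r], so that the lemma can be applied to each of the two variables in turn. *)
Lemma pi_system_indep_l d d1 (T : measurableType d) (T1 : measurableType d1)
    (P : probability T R) (P1 : probability T1 R) (X : T -> T1)
    (G : set (set T1)) (D : set T) (r : {nonneg R}) :
  measurable_fun setT X -> measurable = <<s G >> -> setI_closed G -> G setT ->
  measurable D ->
  (forall A, G A -> P (X @^-1` A `&` D) = (P1 A * r%:num%:E)%E) ->
  forall A, measurable A -> P (X @^-1` A `&` D) = (P1 A * r%:num%:E)%E.
Proof.
move=> mX mG GI GT mD PE A mA.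
pose m : {measure set T1 -> \bar R} :=
  image_measure (mrestr P mD) mX.
have := @measure_unique _ _ _ G (fun=> setT) mG GI (fun=> GT) _ m (mscale r P1).
move=> /(_ _ _ _ A mA); rewrite /mscale/= muleC; apply.
- by apply: bigcup_const; exists 0%N.
- by move=> B GB; rewrite [RHS]muleC; exact: PE.
- move=> k; apply: (@le_lt_trans _ _ 1%E); last exact: ltry.
  by apply: probability_le1; apply: measurableI => //; exact: measurable_preim.
Qed.

Lemma pi_system_indep d d1 d2 (T : measurableType d) (T1 : measurableType d1)
    (T2 : measurableType d2) (P : probability T R) (P1 : probability T1 R)
    (P2 : probability T2 R) (X : T -> T1) (Y : T -> T2)
    (G1 : set (set T1)) (G2 : set (set T2)) :
  measurable_fun setT X -> measurable_fun setT Y ->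
  measurable = <<s G1 >> -> setI_closed G1 -> G1 setT ->
  measurable = <<s G2 >> -> setI_closed G2 -> G2 setT ->
  (forall A B, G1 A -> G2 B -> P (X @^-1` A `&` Y @^-1` B) = (P1 A * P2 B)%E) ->
  forall A B, measurable A -> measurable B ->
    P (X @^-1` A `&` Y @^-1` B) = (P1 A * P2 B)%E.
Proof.
move=> mX mY mG1 GI1 GT1 mG2 GI2 GT2 PE.
have sG2 B : G2 B -> measurable B by rewrite mG2; exact: sub_sigma_algebra.
have H A B : measurable A -> G2 B -> P (X @^-1` A `&` Y @^-1` B) = (P1 A * P2 B)%E.
  move=> mA GB.
  have P20 : 0 <= fine (P2 B) by exact: fine_ge0.
  have P2E : (NngNum P20)%:num%:E = P2 B by rewrite /= fineK// fin_num_measure//; exact: sG2.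
  rewrite -P2E; apply: (pi_system_indep_l mX mG1 GI1 GT1) => //.
    by apply: measurable_preim => //; exact: sG2.
  by move=> A' GA'; rewrite P2E; exact: PE.
move=> A B mA mB.
have P10 : 0 <= fine (P1 A) by exact: fine_ge0.
have P1E : (NngNum P10)%:num%:E = P1 A by rewrite /= fineK// fin_num_measure.
rewrite setIC muleC -P1E; apply: (pi_system_indep_l mY mG2 GI2 GT2) => //.
  exact: measurable_preim.
by move=> B' GB'; rewrite P1E setIC muleC; exact: H.
Qed.

End pushforward_independence.

(** A predicate per digit, instead of a prescribed value, lets a digit be free or impossible: boxes
    are then closed under intersection and can be lengthened by free digits. *)
Definition bit_box (n : nat) (B : nat -> pred bool) : set (nat -> bool) :=
  [set w | forall i, (i < n)%N -> B i (w i)].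

Definition bit_boxes : set (set (nat -> bool)) :=
  [set C | exists n B, C = bit_box n B].

Notation bits := (g_sigma_algebraType bit_boxes).

Lemma bit_box_widen n m B : (n <= m)%N ->
  bit_box n B = bit_box m (fun i b => (i < n)%N ==> B i b).
Proof.
move=> nm; apply/seteqP; split => w /= wB i im.
  by apply/implyP; exact: wB.
by have /implyP := wB i (leq_trans im nm); exact.
Qed.

Lemma bit_boxesT : bit_boxes setT.
Proof. by exists 0%N, (fun _ => predT); apply/seteqP; split. Qed.

Lemma bit_boxesI : setI_closed bit_boxes.
Proof.
move=> _ _ [n [B ->]] [m [C ->]].
rewrite (bit_box_widen B (leq_maxl n m)) (bit_box_widen C (leq_maxr n m)).
exists (maxn n m), (fun i b => ((i < n)%N ==> B i b) && ((i < m)%N ==> C i b)).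
apply/seteqP; split => w /=; first by case=> wB wC i im; rewrite wB ?wC.
by move=> wBC; split => i im; have /andP[] := wBC i im.
Qed.

Lemma measurable_bit_box n B : measurable (bit_box n B : set bits).
Proof. by apply: sub_sigma_algebra; exists n, B. Qed.

Lemma measurable_to_bits d (T : measurableType d) (f : T -> bits) :
  (forall n B, measurable (f @^-1` bit_box n B)) -> measurable_fun setT f.
Proof.
move=> fB.
apply: (@measurability _ _ T bits setT f bit_boxes erefl).
by move=> _ [_ [n [B ->]] <-]; rewrite setTI.
Qed.

Lemma measurable_bit (i : nat) : measurable_fun setT (fun w : bits => w i).
Proof.
move=> _ b _; rewrite setTI.
rewrite (_ : _ @^-1` _ =
  bit_box i.+1 (fun j => if j == i then [pred x | x \in b] else predT)).
  exact: measurable_bit_box.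
apply/seteqP; split => w /=.
  by move=> wb j _; case: eqP => //= ->; rewrite inE.
by move=> /(_ i (ltnSn i)); rewrite eqxx/= inE.
Qed.

Definition even_bits (w : bits) : bits := fun n => w n.*2.
Definition odd_bits (w : bits) : bits := fun n => w n.*2.+1.

(** Digit [i] of a sequence is digit [i./2] of the half selected by the parity of [i]. Taking one of
    the two boxes free also gives the measurability of each half. *)
Lemma even_odd_bit_box n B C :
  even_bits @^-1` bit_box n B `&` odd_bits @^-1` bit_box n C =
  bit_box n.*2 (fun i => if odd i then C i./2 else B i./2).
Proof.
apply/seteqP; split => w /=.
  move=> [wB wC] i ni; have := odd_double_half i; case: (odd i); rewrite /= ?add1n ?add0n => Ei.
    have := wC i./2; rewrite /odd_bits Ei; apply.
    by rewrite -ltn_double (leq_ltn_trans _ ni)// -[leqRHS]Ei.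
  have := wB i./2; rewrite /even_bits Ei; apply.
  by rewrite -ltn_double Ei.
move=> wBC; split => i ni; rewrite /even_bits/odd_bits.
  by have := wBC i.*2; rewrite ltn_double odd_double doubleK; exact.
have := wBC i.*2.+1; rewrite /= odd_double/= uphalf_double.
by apply; rewrite ltn_Sdouble.
Qed.

Lemma measurable_even_bits : measurable_fun setT even_bits.
Proof.
apply: measurable_to_bits => n B.
rewrite (_ : _ @^-1` _ = even_bits @^-1` bit_box n B `&`
    odd_bits @^-1` bit_box n (fun=> predT)).
  by rewrite even_odd_bit_box; exact: measurable_bit_box.
by apply/seteqP; split => w //= [].
Qed.

Lemma measurable_odd_bits : measurable_fun setT odd_bits.
Proof.
apply: measurable_to_bits => n B.
rewrite (_ : _ @^-1` _ = even_bits @^-1` bit_box n (fun=> predT) `&`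
    odd_bits @^-1` bit_box n B).
  by rewrite even_odd_bit_box; exact: measurable_bit_box.
by apply/seteqP; split => w //= [].
Qed.

(** * Binary digits of a real number *)

Section digits.
Context {R : realType}.

(** On [[0, 1[] this is the digit of weight [2 ^- n.+1], in the expansion that ends with zeros at
    dyadic points. *)
Definition digits (u : R) : bits := fun n => odd (Num.truncn (2 ^+ n.+1 * u)).

Lemma truncn_half (u : R) : 0 <= u -> Num.truncn u = (Num.truncn (2 * u))./2.
Proof.
move=> u0; apply: truncn_def.
have /andP[] := truncn_itv (mulr_ge0 (ler0n R 2) u0).
set k := Num.truncn _ => k1; rewrite -natr1 => k2.
have o1 : (odd k)%:R <= 1 :> R by case: (odd k).
have o0 : 0 <= (odd k)%:R :> R by [].
have kE : k%:R = (odd k)%:R + 2 * (k./2)%:R :> R.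
  by rewrite -{1}(odd_double_half k) natrD -muln2 natrM mulrC.
by rewrite -natr1; apply/andP; split; lra.
Qed.

Lemma measurable_truncn : measurable_fun setT (@Num.truncn R).
Proof.
have mI k : measurable [set x : R | (Num.truncn x < k.+1)%N].
  rewrite (_ : [set _ | _] = `]-oo, k.+1%:R[%classic); first exact: measurable_itv.
  by apply/seteqP; split => x /=; rewrite in_itv/= ltnS truncn_le_nat.
have m1 k : measurable [set x : R | Num.truncn x = k].
  case: k => [|k].
    have := mI 0%N; congr measurable; apply/seteqP; split => x /=.
      by rewrite ltnS leqn0 => /eqP.
    by move=> ->.
  have := measurableD (mI k.+1) (mI k); congr measurable; apply/seteqP; split => x /=.
    by rewrite ltnS; move=> [h1 /negP h2]; apply/eqP; rewrite eqn_leq h1 ltnNge -ltnS.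
  by move=> ->; rewrite ltnn.
move=> _ A _; rewrite setTI.
rewrite (_ : _ @^-1` _ = \bigcup_(k in A) [set x : R | Num.truncn x = k]).
  by apply: bigcup_measurable => k _; exact: m1.
by apply/seteqP; split => x /=; [move=> Ax; exists (Num.truncn x)|move=> [k Ak ->]].
Qed.

Lemma measurable_digit n : measurable_fun setT (fun u : R => digits u n).
Proof.
apply: (measurableT_comp (f := odd)) => //.
apply: measurableT_comp; first exact: measurable_truncn.
exact: measurable_funM.
Qed.

Lemma measurable_digits : measurable_fun setT digits.
Proof.
apply: measurable_to_bits => n B.
rewrite (_ : _ @^-1` _ = \bigcap_(i in [set i | (i < n)%N])
    ((fun u : R => digits u i) @^-1` [set b | B i b])).
  apply: bigcap_measurableType => i _.
  by apply: measurable_preim => //; exact: measurable_digit.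
by apply/seteqP; split => u /= uB i; exact: uB.
Qed.

End digits.

Section bits_probability.
Context {R : realType}.
Local Notation U := (@uniform01 R).

Lemma uniform01_subset (A : set R) : A `<=` `[0, 1]%classic ->
  measurable A -> U A = lebesgue_measure A.
Proof.
move=> A01 mA; rewrite /uniform01/= /uniform_prob.
rewrite (eq_integral (cst 1%E)); last first.
  move=> x; rewrite inE => /A01; rewrite /= in_itv/= /uniform_pdf => ->.
  by rewrite subr0 invr1.
by rewrite integral_cst// mul1e.
Qed.

Lemma uniform01_itvco (a b : R) : 0 <= a -> a <= b -> b <= 1 ->
  U `[a, b[%classic = (b - a)%:E.
Proof.
move=> a0 ab b1; rewrite uniform01_subset//; last first.
  move=> x /=; rewrite !in_itv/= => /andP[ax xb].
  by rewrite (le_trans a0 ax) (le_trans (ltW xb) b1).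
rewrite lebesgue_measure_itv/= lte_fin.
by move: ab; rewrite le_eqVlt => /predU1P[->|->//]; rewrite ltxx subrr.
Qed.

Lemma probability_setI1 d (T : measurableType d) (P : probability T R) (A B : set T) :
  measurable A -> measurable B -> P B = 1%E -> P (A `&` B) = P A.
Proof.
move=> mA mB PB; rewrite [RHS](measureDI P mA mB).
have PC : P (~` B) = 0%E by rewrite probability_setC// PB subee.
have : (P (A `\` B) <= P (~` B))%E.
  by apply: le_measure; rewrite ?inE; [exact: measurableD|exact: measurableC|move=> x []].
by rewrite PC measure_le0 => /eqP ->; rewrite add0e.
Qed.

(** The probability that a fair bit satisfies [p]. *)
Definition bit_weight (p : pred bool) : R := ((p true)%:R + (p false)%:R) / 2.

(** The points of the dyadic interval from [N / 2 ^ n] to [(N + 1) / 2 ^ n] whose next [m] digits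
    obey [B]. The condition [0 <= u] is there because [Num.truncn] sends negative numbers to [0]. *)
Definition dyadic_box (n N m : nat) (B : nat -> pred bool) : set R :=
  [set u | [/\ 0 <= u, Num.truncn (2 ^+ n * u) = N &
    forall i, (i < m)%N -> B i (odd (Num.truncn (2 ^+ (n + i).+1 * u)))]].

Lemma measurable_dyadic_box n N m B : measurable (dyadic_box n N m B).
Proof.
rewrite (_ : dyadic_box n N m B = `[0, +oo[%classic `&`
  ((fun u : R => Num.truncn (2 ^+ n * u)) @^-1` [set N] `&`
   \bigcap_(i in [set i | (i < m)%N])
     ((fun u : R => digits u (n + i)) @^-1` [set b | B i b]))).
  apply: measurableI; first exact: measurable_itv.
  apply: measurableI.
    apply: measurable_preim => //; apply: measurableT_comp; first exact: measurable_truncn.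
    exact: measurable_funM.
  apply: bigcap_measurableType => i _.
  by apply: measurable_preim => //; exact: measurable_digit.
apply/seteqP; split => u /=; rewrite in_itv/= andbT.
  by move=> [u0 uN uB]; split => //; split => // i /uB.
by move=> [u0 [uN uB]]; split => // i /uB.
Qed.

Lemma dyadic_boxS n N m B :
  dyadic_box n N m.+1 B =
  (if B 0%N false then dyadic_box n.+1 N.*2 m (fun i => B i.+1) else set0) `|`
  (if B 0%N true then dyadic_box n.+1 N.*2.+1 m (fun i => B i.+1) else set0).
Proof.
apply/seteqP; split => u.
  move=> [u0 uN uB].
  have := truncn_half (mulr_ge0 (exprn_ge0 n (ler0n R 2)) u0).
  rewrite mulrA -exprS uN => NE.
  have uB' i : (i < m)%N ->
      B i.+1 (odd (Num.truncn (2 ^+ (n.+1 + i).+1 * u))).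
    by move=> im; have := uB i.+1; rewrite addnS -addSn; exact.
  have := uB 0%N isT; rewrite addn0.
  have := odd_double_half (Num.truncn (2 ^+ n.+1 * u)); rewrite -NE.
  case: (odd _); rewrite ?add1n ?add0n => tE ->; [right|left]; split => //.
have H (b : bool) (v : R) : Num.truncn (2 ^+ n.+1 * v) = (b + N.*2)%N -> B 0%N b ->
    0 <= v -> (forall i, (i < m)%N ->
      B i.+1 (odd (Num.truncn (2 ^+ (n.+1 + i).+1 * v)))) ->
    dyadic_box n N m.+1 B v.
  move=> vN Bb v0 vB; split => //.
    rewrite truncn_half ?mulr_ge0 ?exprn_ge0// mulrA -exprS vN.
    by case: b {vN Bb} => /=; rewrite ?add1n ?uphalf_double ?add0n ?doubleK.
  move=> [|i] im; last by rewrite addnS -addSn; exact: vB.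
  by rewrite addn0 vN oddD odd_double addbF; case: b Bb {vN}.
case; case: ifP => // B0 [u0 uN uB].
  exact: (H false).
exact: (H true).
Qed.

Lemma dyadic_box_disj n N m B : 
  dyadic_box n N.*2 m B `&` dyadic_box n N.*2.+1 m B = set0.
Proof.
by apply/seteqP; split => u //= [[_ uN _] [_ + _]]; rewrite uN => /n_Sn.
Qed.

(** Induction on the number of digits read, over all dyadic intervals at once: reading one digit
    passes to the two halves. [N < 2 ^ n] keeps the interval inside [[0, 1]], where the uniform law
    is Lebesgue measure. *)
Lemma uniform01_dyadic_box n N m B : (N < 2 ^ n)%N ->
  U (dyadic_box n N m B) = (2 ^- n * \prod_(i < m) bit_weight (B i))%:E.
Proof.
elim: m => [|m IH] in n N B *; move=> Nn.
  rewrite big_ord0 mulr1 (_ : dyadic_box n N 0 B = `[N%:R / 2 ^+ n, N.+1%:R / 2 ^+ n[%classic).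
    rewrite uniform01_itvco//.
    - by congr EFin; rewrite -mulrBl -natr1 addrAC subrr add0r mul1r.
    - by rewrite ler_pM2r ?invr_gt0 ?exprn_gt0// ler_nat.
    - by rewrite ler_pdivrMr ?exprn_gt0// mul1r -natrX ler_nat.
  apply/seteqP; split => u /=; rewrite in_itv/=.
    move=> [u0 uN _]; have := truncn_itv (mulr_ge0 (exprn_ge0 n (ler0n R 2)) u0).
    by rewrite uN ler_pdivrMr ?ltr_pdivlMr ?exprn_gt0// ![u * _]mulrC.
  rewrite ler_pdivrMr ?ltr_pdivlMr ?exprn_gt0// => /andP[h1 h2]; split => //.
    by rewrite -(@pmulr_lge0 _ (2 ^+ n)) ?exprn_gt0// (le_trans _ h1).
  by apply: truncn_def; rewrite mulrC h1 h2.
have N1 : (N.*2 < 2 ^ n.+1)%N by rewrite expnS mul2n ltn_double.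
have N2 : (N.*2.+1 < 2 ^ n.+1)%N by rewrite expnS mul2n ltn_Sdouble.
have mU (b : bool) n' N' B' : measurable (if b then dyadic_box n' N' m B' else set0).
  by case: b => //; exact: measurable_dyadic_box.
have disj (b b' : bool) : (if b then dyadic_box n.+1 N.*2 m (fun i => B i.+1) else set0)
    `&` (if b' then dyadic_box n.+1 N.*2.+1 m (fun i => B i.+1) else set0) = set0.
  by case: b; case: b'; rewrite ?set0I ?setI0 ?dyadic_box_disj.
rewrite dyadic_boxS.
transitivity (U (if B 0%N false then dyadic_box n.+1 N.*2 m (fun i => B i.+1) else set0)
  + U (if B 0%N true then dyadic_box n.+1 N.*2.+1 m (fun i => B i.+1) else set0))%E.
  by apply: measureU; [exact: mU|exact: mU|exact: disj].
rewrite big_ord_recl /= {1}/bit_weight.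
have UE (b : bool) N' : (N' < 2 ^ n.+1)%N ->
  U (if b then dyadic_box n.+1 N' m (fun i => B i.+1) else set0) =
  (b%:R * (2 ^- n.+1 * \prod_(i < m) bit_weight (B i.+1)))%:E.
  by move=> N'n; case: b; rewrite ?measure0 ?mul0r// IH// mul1r.
rewrite !UE// -EFinD; congr EFin.
rewrite exprS; set p := \prod_(i < m) _.
by field; rewrite expf_neq0.
Qed.

Definition bitsP : probability bits R :=
  distribution U (@mfun_of _ _ (measurableTypeR R) bits digits measurable_digits).

Lemma bitsPE A : bitsP A = U (digits @^-1` A).
Proof. by []. Qed.

Lemma bitsP_box n B : bitsP (bit_box n B) = (\prod_(i < n) bit_weight (B i))%:E.
Proof.
(* The point [1] has to be discarded: its integer part is not [0], so it lies outside the dyadic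
   interval of level [0]. *)
pose J : set (measurableTypeR R) := `[0, 1[%classic.
rewrite bitsPE -(@probability_setI1 _ _ _ _ J); last 3 first.
- by apply: measurable_preim; [exact: measurable_digits|exact: measurable_bit_box].
- exact: measurable_itv.
- by rewrite /J uniform01_itvco// subr0.
have := @uniform01_dyadic_box 0 0 n B isT; rewrite expr0 invr1 mul1r => <-.
congr (U _); apply/seteqP; split => u /=; rewrite /J/= in_itv/=.
  move=> [uB /andP[u0 u1]]; split => //.
  by rewrite expr0 mul1r; apply: truncn_def; rewrite u0.
move=> [u0 + uB]; rewrite expr0 mul1r => uN; split; first exact: uB.
by rewrite u0; have := truncnS_gt u; rewrite uN.
Qed.

Lemma prod_bit_weight_even_odd k (B C : nat -> pred bool) :
  \prod_(i < k.*2) bit_weight (if odd i then C i./2 else B i./2) =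
  (\prod_(i < k) bit_weight (B i)) * \prod_(i < k) bit_weight (C i).
Proof.
elim: k => [|k IH]; first by rewrite !big_ord0 mul1r.
rewrite doubleS !big_ord_recr/= IH odd_double/= doubleK uphalf_double.
by rewrite [RHS]mulrACA mulrA.
Qed.

(** On boxes, padded to a common length, both sides are the same product of digit weights;
    pi-systems extend this to all events. *)
Lemma bits_split_indep (A B : set bits) : measurable A -> measurable B ->
  bitsP (even_bits @^-1` A `&` odd_bits @^-1` B) = (bitsP A * bitsP B)%E.
Proof.
apply: (@pi_system_indep _ _ _ _ _ _ _ bitsP bitsP bitsP _ _ bit_boxes bit_boxes).
- exact: measurable_even_bits.
- exact: measurable_odd_bits.
- by [].
- exact: bit_boxesI.
- exact: bit_boxesT.
- by [].
- exact: bit_boxesI.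
- exact: bit_boxesT.
move=> _ _ [n [B1 ->]] [m [B2 ->]].
have [C1 ->] : exists C, bit_box n B1 = bit_box (maxn n m) C.
  by exists (fun i b => (i < n)%N ==> B1 i b); exact/bit_box_widen/leq_maxl.
have [C2 ->] : exists C, bit_box m B2 = bit_box (maxn n m) C.
  by exists (fun i b => (i < m)%N ==> B2 i b); exact/bit_box_widen/leq_maxr.
rewrite even_odd_bit_box !bitsP_box -EFinM; congr EFin.
exact: prod_bit_weight_even_odd.
Qed.

End bits_probability.

(** * The quantile transform *)

Section quantile.
Context {R : realType} (Q : probability (measurableTypeR R) R).

(** The identity, seen as a random variable on the line with law [Q], gives access to the properties
    of [cdf]. *)
Let idR : measurableTypeR R -> R := idfun.
#[local] HB.instance Definition _ :=
  @isMeasurableFun.Build _ _ _ _ idR (@measurable_id _ _ setT).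
Let X : {RV Q >-> R} := idR.

Let F (x : R) : R := fine (Q `]-oo, x]%classic).

Let FE x : (F x)%:E = cdf X x.
Proof. by rewrite /F fineK// fin_num_measure//; exact: measurable_itv. Qed.

Let F_nd x y : x <= y -> F x <= F y.
Proof. by move=> xy; rewrite -lee_fin !FE; exact: cdf_nondecreasing. Qed.

Let F_cvg1 : F x @[x --> +oo] --> (1 : R).
Proof.
exact/fine_cvg/(cvg_cdfy1 X).
Qed.

Let F_cvg0 : F x @[x --> -oo] --> (0 : R).
Proof. exact/fine_cvg/(cvg_cdfNy0 X). Qed.

Let F_rc x : F y @[y --> x^'+] --> F x.
Proof.
have := @cdf_right_continuous _ _ _ _ X x; rewrite -FE => H; exact: (fine_cvg H).
Qed.

Definition quantile (u : R) : R :=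
  if 0 < u < 1 then inf [set x | u <= F x] else 0.

(** The infimum defining the quantile is attained, by right continuity of [F]. *)
Lemma quantile_le (u x : R) : 0 < u < 1 -> (quantile u <= x) = (u <= F x).
Proof.
move=> /[dup] u01 /andP[u0 u1]; rewrite /quantile u01.
have [y Fy] : exists y, F y < u.
  have : \forall y \near -oo, F y < u by apply: (cvgr_lt _ F_cvg0).
  by case=> M [_ FM]; exists (M - 1); apply: FM; rewrite gtrBl.
have [z Fz] : exists z, u < F z.
  have : \forall y \near +oo, u < F y by apply: (cvgr_gt _ F_cvg1).
  by case=> M [_ FM]; exists (M + 1); apply: FM; rewrite ltrDl.
have lbF : has_lbound [set x | u <= F x].
  exists y => t /= ut; rewrite leNgt; apply/negP => ty.
  by have := le_lt_trans (F_nd (ltW ty)) Fy; rewrite ltNge ut.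
apply/idP/idP => [qx|ux]; last exact: ge_inf.
rewrite leNgt; apply/negP => Fx.
(* If [F x < u], then [F] stays below [u] slightly to the right of [x], which pushes the infimum to
   at least [x + e / 2]. *)
have : \forall t \near x^'+, F t < u by apply: (cvgr_lt _ (F_rc (x:=x))).
move=> /nbhs_ballP[e /= e0 He].
have : x + e / 2 <= inf [set x | u <= F x].
  apply: lb_le_inf; first by exists z; exact: ltW.
  move=> t /= ut; rewrite leNgt; apply/negP => te.
  have [tx|xt] := leP t x.
    by have := le_lt_trans (F_nd tx) Fx; rewrite ltNge ut.
  have : F t < u by apply: He => //; rewrite /ball/= ltr0_norm ?subr_lt0// opprB; lra.
  by rewrite ltNge ut.
by move=> /le_trans /(_ qx); rewrite gerDl leNgt divr_gt0.
Qed.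

Lemma cdf_itv01 (x : R) : 0 <= F x <= 1.
Proof.
by rewrite fine_ge0//= -lee_fin FE cdf_le1.
Qed.

Let I01 : set R := `]0, 1[%classic.

Lemma quantile_preimage (x : R) :
  quantile @^-1` `]-oo, x] =
  (I01 `&` `]-oo, F x]%classic) `|` (~` I01 `&` [set _ | 0 <= x]).
Proof.
apply/seteqP; split => u /=; rewrite /I01/= !in_itv/=.
  have [u01|u01] := boolP (0 < u < 1); first by rewrite quantile_le//; left.
  by rewrite /quantile (negbTE u01); right; split => //; exact/negP.
move=> [[u01 uF]|[/negP u01 x0]]; first by rewrite quantile_le.
by rewrite /quantile (negbTE u01).
Qed.

Lemma measurable_quantile :
  measurable_fun setT (quantile : measurableTypeR R -> measurableTypeR R).
Proof.
apply: (measurability (@RGenOInfty.G R)); first exact: RGenOInfty.measurableE.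
move=> _ [_ [x ->] <-]; rewrite setTI.
have -> : quantile @^-1` `]x, +oo[%classic = ~` (quantile @^-1` `]-oo, x]%classic).
  by rewrite preimage_setC setCitvl.
rewrite quantile_preimage.
apply: measurableC; apply: measurableU.
  by apply: measurableI; exact: measurable_itv.
apply: measurableI; first by apply: measurableC; exact: measurable_itv.
case: (boolP (0 <= x)) => x0.
  by rewrite (_ : [set _ | _] = setT)//; apply/seteqP; split.
rewrite (_ : [set _ | _] = set0)//; apply/seteqP; split => //= u.
Qed.

Lemma uniform01_itvNyc (c : R) : 0 <= c <= 1 -> uniform01 `]-oo, c]%classic = c%:E.
Proof.
move=> /andP[c0 c1].
rewrite -(@probability_setI1 _ _ _ (@uniform01 R) _ (`[0, 1[%classic : set R)); last 3 first.
- exact: measurable_itv.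
- exact: measurable_itv.
- by rewrite uniform01_itvco// subr0.
rewrite uniform01_subset; last 2 first.
- by move=> x [_] /=; rewrite !in_itv/= => /andP[-> /ltW].
- by apply: measurableI; exact: measurable_itv.
apply/eqP; rewrite eq_le; apply/andP; split.
  apply: (@le_trans _ _ (lebesgue_measure (`[0, c]%classic : set R))).
    apply: le_measure; rewrite ?inE.
    - by apply: measurableI; exact: measurable_itv.
    - exact: measurable_itv.
    - by move=> x [] /=; rewrite !in_itv/= => -> /andP[->].
  rewrite lebesgue_measure_itv/= lte_fin; case: ifPn => _.
    by rewrite oppr0 adde0.
  by rewrite lee_fin.
apply: (@le_trans _ _ (lebesgue_measure (`[0, c[%classic : set R))).
  rewrite lebesgue_measure_itv/= lte_fin; case: ifPn => [_|].
    by rewrite oppr0 adde0.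
  by rewrite -leNgt lee_fin.
apply: le_measure; rewrite ?inE.
- exact: measurable_itv.
- by apply: measurableI; exact: measurable_itv.
- move=> x /=; rewrite !in_itv/= => /andP[-> xc].
  by rewrite (ltW xc) (lt_le_trans xc c1).
Qed.

(** By [quantile_le], the preimage of a ray is, inside []0, 1[], the ray ending at [F x]; the rest
    is negligible for the uniform law. *)
Lemma quantile_law (B : set R) : measurable B ->
  uniform01 (quantile @^-1` B) = Q B.
Proof.
pose q := @mfun_of _ _ (measurableTypeR R) (measurableTypeR R) quantile measurable_quantile.
apply: (@probability_eq_rays _ (distribution (@uniform01 R) q) Q) => x.
have mI : measurable I01 by exact: measurable_itv.
have I1 : uniform01 I01 = 1%E.
  rewrite uniform01_subset//; last by move=> t /=; rewrite !in_itv/= => /andP[/ltW -> /ltW ->].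
  by rewrite lebesgue_measure_itv/= lte_fin ltr01 oppr0 adde0.
transitivity (uniform01 (quantile @^-1` `]-oo, x]%classic)); first by [].
have mq : measurable (quantile @^-1` `]-oo, x]%classic : set (measurableTypeR R)).
  by apply: (measurable_preim measurable_quantile); exact: measurable_itv.
rewrite -(probability_setI1 mq mI I1) quantile_preimage.
rewrite (_ : _ `&` I01 = `]-oo, F x]%classic `&` I01); last first.
  by apply/seteqP; split => u /=; [move=> [[[]|[]]]|tauto].
have mJ : measurable (`]-oo, F x]%classic : set (measurableTypeR R)) by exact: measurable_itv.
rewrite (probability_setI1 mJ mI I1).
by rewrite uniform01_itvNyc ?cdf_itv01// FE.
Qed.

End quantile.

(** * A uniform variable recovered from fair bits *)

Section binary_expansion.
Context {R : realType}.

Definition binary_sum (w : bits) (n : nat) : R :=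
  \sum_(i < n) (w i)%:R / 2 ^+ i.+1.

Definition binary_value (w : bits) : R := limn (binary_sum w).

Lemma binary_sum_le (w : bits) n : binary_sum w n <= 1 - 2 ^- n.
Proof.
rewrite /binary_sum; elim: n => [|n IH].
  by rewrite big_ord0 expr0 invr1 subrr.
rewrite big_ord_recr/=.
have h : (w n)%:R / 2 ^+ n.+1 <= 2 ^- n.+1 :> R.
  by rewrite ler_pdivrMr ?exprn_gt0// mulVf ?expf_neq0//; case: (w n).
have -> : 1 - 2 ^- n.+1 = 1 - 2 ^- n + 2 ^- n.+1 :> R.
  by rewrite exprS; field; rewrite expf_neq0.
exact: lerD.
Qed.

Lemma is_cvg_binary_sum (w : bits) : cvgn (binary_sum w).
Proof.
apply: nondecreasing_is_cvgn.
  apply/nondecreasing_seqP => n; rewrite /binary_sum big_ord_recr/= lerDl.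
  by rewrite divr_ge0// exprn_ge0.
exists 1 => _ [n _ <-]; rewrite (le_trans (binary_sum_le _ _))// gerBl.
Qed.

Lemma measurable_binary_value : measurable_fun setT binary_value.
Proof.
apply: (@measurable_fun_cvg _ _ _ _ (fun n w => binary_sum w n)).
  move=> n; apply: measurable_sum => i.
  apply: measurable_funM => //.
  apply: (@measurableT_comp _ _ _ _ _ _ (fun b : bool => b%:R : R)) => //.
  exact: measurable_bit.
by move=> w _; exact: is_cvg_binary_sum.
Qed.

Lemma binary_sum_digits (u : R) n : 0 <= u < 1 ->
  binary_sum (digits u) n = (Num.truncn (2 ^+ n * u))%:R / 2 ^+ n.
Proof.
move=> /andP[u0 u1]; rewrite /binary_sum; elim: n => [|n IH].
  rewrite big_ord0 expr0 mul1r divr1.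
  by have -> : Num.truncn u = 0%N by apply: truncn_def; rewrite u0.
rewrite big_ord_recr/= IH (truncn_half (mulr_ge0 (exprn_ge0 n (ler0n R 2)) u0)).
rewrite mulrA -exprS /digits -[in RHS](odd_double_half (Num.truncn (2 ^+ n.+1 * u))).
set k := Num.truncn _.
rewrite natrD -muln2 natrM exprS; field.
by rewrite expf_neq0.
Qed.

Lemma binary_value_digits (u : R) : 0 <= u < 1 -> binary_value (digits u) = u.
Proof.
move=> u01; have /andP[u0 u1] := u01; apply/cvg_lim => //.
apply: (@squeeze_cvgr _ _ _ _ (fun n => u - 2 ^- n) (fun=> u)).
- apply: nearW => n; rewrite binary_sum_digits//.
  have /andP[h1 h2] := truncn_itv (mulr_ge0 (exprn_ge0 n (ler0n R 2)) u0).
  rewrite ler_pdivrMr ?exprn_gt0// ler_pdivlMr ?exprn_gt0// [u * _]mulrC h1 andbT.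
  rewrite mulrBl mulVf ?expf_neq0// lerBlDr mulrC natr1; exact: ltW.
- rewrite -[X in _ --> X]subr0; apply: cvgB; first exact: cvg_cst.
  rewrite (_ : (fun n => 2 ^- n) = (fun n => (2^-1) ^+ n)); last first.
    by apply/funext => n; rewrite exprVn.
  by apply: cvg_expr; rewrite ger0_norm// invf_lt1// ltr1n.
- exact: cvg_cst.
Qed.

(** [bitsP] is by definition the law of [digits], so the law sought is that of
    [binary_value \o digits], which is the identity on [[0, 1[]. *)
Lemma bitsP_binary_value (A : set R) : measurable A ->
  bitsP (binary_value @^-1` A) = @uniform01 R A.
Proof.
move=> mA; rewrite bitsPE.
pose J : set (measurableTypeR R) := `[0, 1[%classic.
have mJ : measurable J by exact: measurable_itv.
have J1 : uniform01 J = 1%E by rewrite /J uniform01_itvco// subr0.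
have mA' : measurable (A : set (measurableTypeR R)) := mA.
have mD : measurable ((@digits R : measurableTypeR R -> _) @^-1` (binary_value @^-1` A)).
  apply: measurable_preim; first exact: measurable_digits.
  by apply: measurable_preim; first exact: measurable_binary_value.
rewrite -(probability_setI1 mD mJ J1) -(probability_setI1 mA' mJ J1).
congr (uniform01 _); apply/seteqP; split => u /=; rewrite /J/= in_itv/= => -[];
  by move=> + u01; rewrite /preimage/= binary_value_digits.
Qed.

Lemma exists_bits_law (Q : probability (measurableTypeR R) R) :
  exists2 G : bits -> R, measurable_fun setT G &
    forall B, measurable B -> bitsP (G @^-1` B) = Q B.
Proof.
exists (quantile Q \o binary_value).
  exact: measurableT_comp (measurable_quantile Q) measurable_binary_value.
move=> B mB; rewrite comp_preimage bitsP_binary_value ?quantile_law//.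
exact: (measurable_preim (measurable_quantile Q)).
Qed.

End binary_expansion.

(** * Centered Gaussian laws and their limits *)

Section centered_gaussian_law.
Context {R : realType}.

(* The law of [s * Z] with [Z] standard normal; it is the Dirac mass at [0]
   when [s = 0]. *)
Definition gauss (s : R) : probability (measurableTypeR R) R :=
  distribution (normal_prob 0 1) (@mfun_of _ _ (measurableTypeR R)
    (measurableTypeR R) (fun x => s * x + 0) (measurable_affine s 0)).

Lemma gaussE (s : R) (B : set R) :
  gauss s B = normal_prob 0 1 ((fun z => s * z) @^-1` B).
Proof.
rewrite /gauss/= /distribution/= /pushforward/=; congr (normal_prob 0 1 _).
by apply/seteqP; split => x /=; rewrite addr0.
Qed.

Lemma gauss_gt0 (s : R) (B : set R) : 0 < s -> measurable B ->
  gauss s B = normal_prob 0 s B.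
Proof. by move=> s0 mB; rewrite gaussE -normal_prob_scale. Qed.

Lemma gauss0 (B : set R) : measurable B -> gauss 0 B = dirac (0 : R) B.
Proof.
move=> mB; rewrite gaussE.
rewrite /dirac indicE; case: (boolP (0 \in B)) => B0.
  rewrite (_ : _ @^-1` _ = setT) ?probability_setT//.
  by apply/seteqP; split => x //= _; rewrite mul0r; exact: set_mem.
rewrite (_ : _ @^-1` _ = set0) ?measure0//.
apply/seteqP; split => x //=; rewrite mul0r => B0'.
by move: B0; rewrite notin_setE.
Qed.

Lemma gaussN (s : R) (B : set R) : measurable B -> gauss (- s) B = gauss s B.
Proof.
move=> mB; rewrite !gaussE -[RHS]normal_prob_sym; last first.
  by apply: measurable_preim => //; exact: measurable_funM.
congr (normal_prob 0 1 _); apply/seteqP; split => x /=; by rewrite mulrN mulNr.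
Qed.

(** Only the variance matters. Later statements can therefore accept any [c] with the prescribed
    square, of either sign. *)
Lemma gauss_sqr (s t : R) (B : set R) : s ^+ 2 = t ^+ 2 -> measurable B ->
  gauss s B = gauss t B.
Proof.
move=> /eqP; rewrite eqf_sqr => /orP[/eqP ->//|/eqP -> mB]; exact: gaussN.
Qed.

Lemma gauss_normal_law (s : R) (B : set R) : 0 <= s -> measurable B ->
  gauss s B = normal_law 0 s B.
Proof.
move=> s0 mB; rewrite /normal_law; case: eqVneq => [->|sn0]; first exact: gauss0.
by rewrite gauss_gt0// lt_neqAle eq_sym sn0.
Qed.

Lemma gauss_convolution (s t c : R) (B : set R) : c ^+ 2 = s ^+ 2 + t ^+ 2 ->
  measurable B -> (gauss s \x gauss t)%E [set p | B (p.1 + p.2)] = gauss c B.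
Proof.
move=> cE mB.
have mC : measurable [set p : measurableTypeR R * measurableTypeR R | B (p.1 + p.2)].
  rewrite -[X in measurable X]setTI.
  by apply: (measurable_funD (@measurable_fst _ _ (measurableTypeR R) (measurableTypeR R))
     (@measurable_snd _ _ (measurableTypeR R) (measurableTypeR R))).
have sec (m : probability (measurableTypeR R) R) x :
    m (xsection [set p : measurableTypeR R * measurableTypeR R | B (p.1 + p.2)] x) =
    m ((fun y => x + y) @^-1` B).
  by rewrite xsectionE.
(* A Dirac factor has no density, so the two degenerate cases are settled by hand before
   [normal_convolution] applies. *)
have [s0|s0] := eqVneq s 0.
  have -> : gauss c B = gauss t B.
    by apply: gauss_sqr => //; rewrite cE s0 expr0n add0r.
  rewrite /product_measure1 s0 (eq_measure_integral (dirac (0 : measurableTypeR R))); last first.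
    by move=> A mA _; exact: gauss0.
  rewrite integral_dirac//; last exact: measurable_fun_xsection.
  rewrite diracT mul1e; apply: (etrans (sec (gauss t) _)); congr (gauss t _).
  by apply/seteqP; split => y /=; rewrite add0r.
have [t0|t0] := eqVneq t 0.
  have -> : gauss c B = gauss s B.
    by apply: gauss_sqr => //; rewrite cE t0 expr0n addr0.
  rewrite /product_measure1 t0.
  transitivity (\int[gauss s]_x (\1_B x)%:E)%E; last by rewrite integral_indic// setIT.
  apply: eq_integral => x _; apply: (etrans (sec (gauss 0) _)); rewrite gauss0; last first.
    by apply: measurable_preim => //; exact: measurable_funD.
  rewrite diracE indicE; congr (nat_of_bool _)%:R%:E.
  by apply/idP/idP; rewrite !inE /=  addr0.
have c0 : 0 < `|c|.
  rewrite normr_gt0 -(sqrf_eq0 c) cE gt_eqF// ltr_wpDr ?sqr_ge0//.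
  by rewrite exprn_even_gt0.
have nE : (`|c| ^+ 2 = `|s| ^+ 2 + `|t| ^+ 2) by rewrite !real_normK ?num_real.
have s1 : 0 < `|s| by rewrite normr_gt0.
have t1 : 0 < `|t| by rewrite normr_gt0.
have absE (r : R) A : 0 < `|r| -> measurable A -> gauss r A = normal_prob 0 `|r| A.
  move=> r0 mA; rewrite -gauss_gt0//; apply: gauss_sqr => //.
  by rewrite real_normK ?num_real.
rewrite (absE c)// -(normal_convolution s1 t1 c0 nE mB).
rewrite /product_measure1 (eq_measure_integral (normal_prob 0 `|s|)); last first.
  by move=> A mA _; exact: absE.
apply: eq_integral => x _; apply: absE => //.
exact: measurable_xsection.
Qed.

(** Independence identifies the joint law with the product measure, by uniqueness on rectangles; the
    law of the sum is then a convolution. *)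
Lemma gauss_indepD d (T : measurableType d) (P : probability T R)
    (X Y : T -> R) (s t c : R) :
  measurable_fun setT X -> measurable_fun setT Y ->
  (forall B, measurable B -> P (X @^-1` B) = gauss s B) ->
  (forall B, measurable B -> P (Y @^-1` B) = gauss t B) ->
  (forall A B, measurable A -> measurable B ->
    P (X @^-1` A `&` Y @^-1` B) = (P (X @^-1` A) * P (Y @^-1` B))%E) ->
  c ^+ 2 = s ^+ 2 + t ^+ 2 ->
  forall B, measurable B -> P ((fun w => X w + Y w) @^-1` B) = gauss c B.
Proof.
move=> mX mY XE YE XY cE B mB; rewrite -(gauss_convolution cE mB).
have mXY : measurable_fun setT (fun w => (X w, Y w) : measurableTypeR R * measurableTypeR R).
  exact: measurable_fun_pair.
pose m : {measure set (measurableTypeR R * measurableTypeR R) -> \bar R} :=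
  image_measure P mXY.
rewrite (product_measure_unique (m' := m))//.
- move=> A A' mA mA'; transitivity (P (X @^-1` A) * P (Y @^-1` A'))%E.
    exact: XY.
  by rewrite XE// YE.
- rewrite -[X in measurable X]setTI.
  by apply: (measurable_funD (@measurable_fst _ _ (measurableTypeR R) (measurableTypeR R))
     (@measurable_snd _ _ (measurableTypeR R) (measurableTypeR R))).
Qed.

End centered_gaussian_law.

(** * A sequence of independent standard normal variables *)

Section gaussian_sequence.
Context {R : realType}.

Lemma exists_gaussian_sequence : exists2 g : nat -> bits -> R,
  (forall n, measurable_fun setT (g n)) &
  forall (n : nat) (a : nat -> R) (c : R), c ^+ 2 = \sum_(k < n) a k ^+ 2 ->
  forall B, measurable B ->
  bitsP ((fun w => \sum_(k < n) a k * g k w) @^-1` B) = gauss c B.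
Proof.
have [G mG GE] := exists_bits_law (normal_prob 0 1 : probability (measurableTypeR R) R).
have miter k : measurable_fun setT (fun w : bits => iter k odd_bits w).
  elim: k => [|k IH]; first exact: measurable_id.
  exact: (measurableT_comp measurable_odd_bits IH).
(* Each variable consumes the even digits of what its predecessors left and passes on the odd
   ones. *)
pose g k (w : bits) := G (even_bits (iter k odd_bits w)).
have mg k : measurable_fun setT (g k).
  apply: (measurableT_comp mG); exact: (measurableT_comp measurable_even_bits (miter k)).
exists g => //.
have evenP A : measurable A -> bitsP (even_bits @^-1` A) = @bitsP R A.
  move=> mA; have := @bits_split_indep R A setT mA measurableT.
  by rewrite preimage_setT setIT probability_setT mule1.
have oddP A : measurable A -> bitsP (odd_bits @^-1` A) = @bitsP R A.
  move=> mA; have := @bits_split_indep R setT A measurableT mA.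
  by rewrite preimage_setT setTI probability_setT mul1e.
elim => [|n IH] a c.
  rewrite big_ord0 => /eqP; rewrite sqrf_eq0 => /eqP -> B mB.
  rewrite gauss0// diracE; case: (boolP (0 \in B)) => B0.
    rewrite (_ : _ @^-1` _ = setT) ?probability_setT//.
    by apply/seteqP; split => w //= _; rewrite big_ord0; exact: set_mem.
  rewrite (_ : _ @^-1` _ = set0) ?measure0//.
  apply/seteqP; split => w //=; rewrite big_ord0 => B0'.
  by move: B0; rewrite notin_setE.
rewrite big_ord_recl => cE B mB.
pose S (w : bits) := \sum_(k < n) a k.+1 * g k w.
have mS : measurable_fun setT S.
  by apply: measurable_sum => k; apply: measurable_funM.
pose X (w : bits) := a 0%N * G w.
have mX : measurable_fun setT X by apply: measurable_funM.
(* The first term reads the even digits; the others form the same kind of sum, with shifted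
   coefficients, evaluated at the odd digits. The induction hypothesis applies to them because it
   quantifies over all coefficients. *)
rewrite (_ : (fun w => _) = (fun w => (X \o even_bits) w + (S \o odd_bits) w)); last first.
  apply/funext => w; rewrite big_ord_recl; congr (_ + _).
  by apply: eq_bigr => k _; rewrite /g/= /bump/= add1n -iterSr.
have sE : Num.sqrt (\sum_(k < n) a k.+1 ^+ 2) ^+ 2 = \sum_(k < n) a k.+1 ^+ 2.
  by rewrite sqr_sqrtr// sumr_ge0// => k _; exact: sqr_ge0.
apply: (@gauss_indepD _ _ _ _ _ _ (a 0%N) (Num.sqrt (\sum_(k < n) a k.+1 ^+ 2))) => //.
- exact: (measurableT_comp mX measurable_even_bits).
- exact: (measurableT_comp mS measurable_odd_bits).
- move=> A mA; rewrite comp_preimage evenP; last exact: measurable_preim.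
  rewrite gaussE -GE//; apply: measurable_preim => //; exact: measurable_funM.
- move=> A mA; rewrite comp_preimage oddP; last exact: measurable_preim.
  exact: (IH (fun k => a k.+1)).
- move=> A A' mA mA'.
  have mA1 := measurable_preim mX mA; have mA2 := measurable_preim mS mA'.
  transitivity (@bitsP R (X @^-1` A) * @bitsP R (S @^-1` A'))%E.
    exact: bits_split_indep.
  by congr (_ * _)%E; apply/esym; [exact: evenP|exact: oddP].
- by rewrite sE cE; congr (_ + _); apply: eq_bigr => k _; rewrite /bump/= add1n.
Qed.

End gaussian_sequence.

(** * Almost sure limits of centered normal variables *)

Section gaussian_limits.
Context {R : realType}.

(** For [n >= 1], equal to 1 up to [x] and to 0 beyond [x + 1 / n], affine in between: a continuous
    bounded substitute for the indicator of []-oo, x]], which can be tested against almost sure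
    limits. *)
Definition ramp (x : R) (n : nat) (t : R) : R :=
  Num.max 0 (Num.min 1 (1 - n%:R * (t - x))).

Lemma ramp_ge0 x n t : 0 <= ramp x n t.
Proof. by rewrite /ramp le_max lexx. Qed.

Lemma ramp_le1 x n t : ramp x n t <= 1.
Proof. by rewrite /ramp ge_max ler01 ge_min lexx. Qed.

Lemma continuous_ramp x n : continuous (ramp x n).
Proof.
pose u (t : R) := 1 - n%:R * (t - x).
have cu : continuous u.
  move=> t; apply: cvgB; first exact: cvg_cst.
  by apply: cvgMr; apply: cvgB; [exact: cvg_id|exact: cvg_cst].
pose v t := Num.min 1 (u t).
have cv : continuous v.
  rewrite (_ : v = fun t => (1 + u t - `|1 - u t|) / 2); last first.
    by apply/funext => t; rewrite /v minr_absE.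
  move=> t; apply: cvgMl; apply: cvgB.
    by apply: cvgD; [exact: cvg_cst|exact: cu].
  by apply: cvg_norm; apply: cvgB; [exact: cvg_cst|exact: cu].
rewrite (_ : ramp x n = fun t => (0 + v t + `|0 - v t|) / 2); last first.
  by apply/funext => t; rewrite /ramp maxr_absE.
move=> t; apply: cvgMl; apply: cvgD.
  by apply: cvgD; [exact: cvg_cst|exact: cv].
by apply: cvg_norm; apply: cvgB; [exact: cvg_cst|exact: cv].
Qed.

Lemma measurable_ramp x n : measurable_fun setT (ramp x n).
Proof. by apply: continuous_measurable_fun; exact: continuous_ramp. Qed.

Lemma cvg_ramp x t : ramp x n t @[n --> \oo] --> (\1_(`]-oo, x]%classic) t : R).
Proof.
rewrite indicE; case: (boolP (t \in _)); rewrite ?notin_setE ?inE/= in_itv/= => tx.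
  rewrite (_ : (fun n => _) = cst 1); first exact: cvg_cst.
  apply/funext => n; rewrite /ramp (min_idPl _) ?(max_idPr _)//.
  by rewrite lerBrDr -lerBrDl subrr mulr_ge0_le0// subr_le0.
move/negP: tx; rewrite -ltNge => xt.
apply: cvg_near_cst; near=> n.
rewrite /ramp; apply/max_idPl; rewrite ge_min; apply/orP; right.
rewrite subr_le0 -ler_pdivrMr ?subr_gt0//.
by near: n; exact: nbhs_infty_ger.
Unshelve. all: by end_near. Qed.

Lemma cvg_integral_bounded d (T : measurableType d) (P : probability T R)
    (f : nat -> T -> R) (g : T -> R) :
  (forall n, measurable_fun setT (f n)) -> measurable_fun setT g ->
  (forall n x, 0 <= f n x <= 1) ->
  {ae P, forall x, f n x @[n --> \oo] --> g x} ->
  (\int[P]_x (f n x)%:E)%E @[n --> \oo] --> (\int[P]_x (g x)%:E)%E.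
Proof.
move=> mf mg f01 fg.
have := @dominated_convergence _ T R P setT measurableT (fun n x => (f n x)%:E)
  (EFin \o g) (cst 1%E).
case => //.
- by move=> n; exact/measurable_EFinP.
- exact/measurable_EFinP.
- apply: filterS fg => x fgx _; apply: cvg_EFin; [exact: nearW|exact: fgx].
- exact: finite_measure_integrable_cst.
- by apply: aeW => x n _ /=; rewrite lee_fin ger0_norm; have /andP[] := f01 n x.
Qed.

Lemma probability_eq_ramp (P Q : probability (measurableTypeR R) R) :
  (forall x n, (\int[P]_t (ramp x n t)%:E = \int[Q]_t (ramp x n t)%:E)%E) ->
  forall A : set R, measurable A -> P A = Q A.
Proof.
move=> PQ; apply: probability_eq_rays => x.
pose J : set (measurableTypeR R) := `]-oo, x]%classic.
have mJ : measurable J by exact: measurable_itv.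
have H (m : probability (measurableTypeR R) R) :
    (\int[m]_t (ramp x n t)%:E)%E @[n --> \oo] --> m J.
  have := @cvg_integral_bounded _ _ m (ramp x) (\1_J).
  rewrite integral_indic// setIT; apply.
  - by move=> n; exact: measurable_ramp.
  - exact: measurable_indic.
  - by move=> n t; rewrite ramp_ge0 ramp_le1.
  - by apply: aeW => t; exact: cvg_ramp.
have HP := H P; have HQ := H Q.
move: HP; rewrite (_ : (fun n => _) = (fun n => \int[Q]_t (ramp x n t)%:E)%E); last first.
  by apply/funext => n; rewrite PQ.
by move=> /cvg_unique; apply.
Qed.

(* Uniformly in [s], including [s = 0], integrals against [gauss s] are
   integrals against the standard normal law. *)
Lemma integral_gauss (s : R) (f : R -> R) : measurable_fun setT f ->
  (forall x, 0 <= f x) ->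
  (\int[gauss s]_x (f x)%:E = \int[normal_prob 0 1]_x (f (s * x))%:E)%E.
Proof.
move=> mf f0; rewrite /gauss.
rewrite ge0_integral_distribution//=; last by exact/measurable_EFinP.
by apply: eq_integral => x _ /=; rewrite addr0.
Qed.

(** Integrals of ramps converge on both sides by dominated convergence: on the left along [X n], on
    the right because all [gauss (s n)] are images of one normal law under dilations converging
    pointwise. A limit variance of 0 needs no separate treatment. *)
Lemma gauss_limit d (T : measurableType d) (P : probability T R)
    (X : nat -> T -> R) (Y : T -> R) (s : nat -> R) (t : R) :
  (forall n, measurable_fun setT (X n)) -> measurable_fun setT Y ->
  (forall n B, measurable B -> P (X n @^-1` B) = gauss (s n) B) ->
  {ae P, forall w, X n w @[n --> \oo] --> Y w} ->
  s n @[n --> \oo] --> t ->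
  forall B, measurable B -> P (Y @^-1` B) = gauss t B.
Proof.
move=> mX mY XE XY st.
apply: (@probability_eq_ramp
  (distribution P (@mfun_of _ _ _ (measurableTypeR R) Y mY)) (gauss t)) => x m.
have mr := measurable_ramp x m.
have H1 : (\int[P]_w (ramp x m (X n w))%:E)%E @[n --> \oo] -->
    (\int[P]_w (ramp x m (Y w))%:E)%E.
  apply: cvg_integral_bounded.
  - by move=> n; exact: (measurableT_comp mr (mX n)).
  - exact: (measurableT_comp mr mY).
  - by move=> n w; rewrite ramp_ge0 ramp_le1.
  - apply: filterS XY => w Xw; apply: continuous_cvg => //; exact: continuous_ramp.
have H2 : (\int[normal_prob 0 1]_z (ramp x m (s n * z))%:E)%E @[n --> \oo] -->
    (\int[normal_prob 0 1]_z (ramp x m (t * z))%:E)%E.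
  apply: cvg_integral_bounded.
  - by move=> n; apply: (measurableT_comp mr); exact: measurable_funM.
  - by apply: (measurableT_comp mr); exact: measurable_funM.
  - by move=> n w; rewrite ramp_ge0 ramp_le1.
  - apply: aeW => z; apply: continuous_cvg; first exact: continuous_ramp.
    exact: cvgMl.
rewrite ge0_integral_distribution//=; last 2 first.
- exact/measurable_EFinP.
- by move=> y; rewrite lee_fin ramp_ge0.
rewrite [RHS]integral_gauss//; last by move=> y; exact: ramp_ge0.
suff E n : (\int[P]_w (ramp x m (X n w))%:E =
    \int[normal_prob 0 1]_z (ramp x m (s n * z))%:E)%E.
  apply: (cvg_unique _ H1) => //; apply: cvg_trans H2.
  by apply: near_eq_cvg; apply: nearW => n; rewrite E.
rewrite -integral_gauss//; last by move=> y; exact: ramp_ge0.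
have := @ge0_integral_distribution _ _ _ _ _ P
  (@mfun_of _ _ _ (measurableTypeR R) (X n) (mX n))
  (fun y => (ramp x m y)%:E).
move=> /= <-.
- by apply: eq_measure_integral => A mA _; exact: XE.
- exact/measurable_EFinP.
- by move=> y; rewrite lee_fin ramp_ge0.
Qed.

End gaussian_limits.

(** * Gaussian processes from square-summable families *)

Lemma cvg_subseq_ge {T : topologicalType} (u : nat -> T) (h : nat -> nat) (l : T) :
  (forall k, k <= h k)%N -> u @ \oo --> l -> u (h k) @[k --> \oo] --> l.
Proof.
move=> hk ul; apply: (cvg_comp h u _ ul) => A [N _ NA].
by exists N => // k Nk; apply: NA; exact: leq_trans (hk k).
Qed.

Section almost_sure_limit.
Context {R : realType} d (T : measurableType d) (P : probability T R).

(** The sum of the absolute increments has finite expectation, hence is almost surely finite, and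
    the telescoping series converges absolutely. *)
Lemma ae_cvg_of_summable_increments (Y : nat -> T -> R) :
  (forall k, measurable_fun setT (Y k)) ->
  (forall k, (\int[P]_w `|Y k.+1 w - Y k w|%:E <= (1 / (2 ^ (k + 1))%:R)%:E)%E) ->
  exists2 Z : T -> R, measurable_fun setT Z &
    {ae P, forall w, Y k w @[k --> \oo] --> Z w}.
Proof.
move=> mY YE.
(* The upper limit is measurable everywhere and coincides with the limit wherever that exists. *)
exists (fun w => fine (limn_esup (fun k => (Y k w)%:E))).
  apply: (measurableT_comp (fine_measurable _)) => //.
  by apply: measurable_fun_limn_esup => k; exact/measurable_EFinP.
pose D k w : \bar R := (`|Y k.+1 w - Y k w|)%:E.
have mD k : measurable_fun setT (D k).
  apply/measurable_EFinP; apply: measurableT_comp => //.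
  exact: measurable_funB.
have D0 k w : (0 <= D k w)%E by rewrite lee_fin.
have intD : (\int[P]_w (\sum_(k <oo) D k w) < +oo)%E.
  rewrite integral_nneseries//.
  apply: (@le_lt_trans _ _ (\sum_(k <oo) (1 / (2 ^ (k + 1))%:R)%:E)%E).
    apply: lee_nneseries => k *; [exact: integral_ge0|exact: YE].
  have /cvg_lim := @cvg_geometric_eseries_half R 1 0.
  by rewrite expr0 divr1 => ->//; rewrite ltry.
have mSD : measurable_fun setT (fun w => \sum_(k <oo) D k w)%E.
  by apply: ge0_emeasurable_sum.
have : P.-integrable setT (fun w => \sum_(k <oo) D k w)%E.
  apply/integrableP; split => //.
  under eq_integral do rewrite gee0_abs ?nneseries_ge0//.
  exact: intD.
move=> /(integrable_ae measurableT); apply: filterS => w /(_ I) Sfin.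
have cY : cvgn (fun k => Y k w).
  pose u k := Y k w.
  have cs : cvgn (series (telescope u)).
    apply: normed_cvg.
    apply: nondecreasing_is_cvgn.
      apply/nondecreasing_seqP => n; rewrite -subr_ge0 seriesSB; exact: normr_ge0.
    exists (fine (\sum_(k <oo) D k w)%E) => _ [n _ <-].
    rewrite -lee_fin fineK// /series/= -sumEFin.
    exact: nneseries_lim_ge.
  have -> : (fun k => Y k w) = (fun n => u 0%N + series (telescope u) n).
    by apply/funext => n; rewrite -eq_sum_telescope.
  by apply: is_cvgD; [exact: is_cvg_cst|exact: cs].
have cE : (fun k => (Y k w)%:E) @ \oo --> (limn (fun k => Y k w))%:E.
  by apply: cvg_EFin; [exact: nearW|exact: cY].
by rewrite (is_cvg_limn_esupE (cvgP _ cE)) (cvg_lim _ cE).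
Qed.

End almost_sure_limit.

Section gauss_abs.
Context {R : realType}.

(** From [(|z| - 1) ^ 2 >= 0], [|z|] is at most [(1 + z ^ 2) / 2], whose standard normal mean is
    1. *)
Lemma integral_abs_gauss_le d (T : measurableType d) (P : probability T R)
    (X : T -> R) (s : R) : measurable_fun setT X ->
  (forall B, measurable B -> P (X @^-1` B) = gauss s B) ->
  (\int[P]_w `|X w|%:E <= `|s|%:E)%E.
Proof.
move=> mX XE.
have ma : measurable_fun setT (fun y : measurableTypeR R => `|y|%:E).
  exact/measurable_EFinP.
have := @ge0_integral_distribution _ _ _ _ _ P
  (@mfun_of _ _ _ (measurableTypeR R) X mX) (fun y => `|y|%:E) ma (fun y => normr_ge0 y).
move=> /= <-.
rewrite (eq_measure_integral (gauss s)); last by move=> A mA _; exact: XE.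
rewrite integral_gauss//.
have mz : measurable_fun setT (fun z : R => (2^-1 * (1 + z ^+ 2))%:E).
  by apply/measurable_EFinP; apply: measurable_funM => //; exact: measurable_funD.
apply: (@le_trans _ _ (\int[normal_prob 0 1]_z (`|s| * (2^-1 * (1 + z ^+ 2)))%:E)%E).
  apply: ge0_le_integral => //.
  - by apply/measurable_EFinP; apply: measurableT_comp => //; exact: measurable_funM.
  - by apply/measurable_EFinP; apply: measurable_funM => //; exact/measurable_EFinP.
  - move=> z _; rewrite lee_fin normrM ler_wpM2l//.
    have : 0 <= (`|z| - 1) ^+ 2 by exact: sqr_ge0.
    by rewrite sqrrB1 real_normK ?num_real//; lra.
under eq_integral do rewrite EFinM.
rewrite ge0_integralZl_EFin//; last first.
  by move=> z _; rewrite lee_fin mulr_ge0// addr_ge0// sqr_ge0.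
under eq_integral do rewrite EFinM EFinD.
rewrite ge0_integralZl_EFin//; last 2 first.
- by move=> z _; rewrite -EFinD lee_fin addr_ge0// sqr_ge0.
- by apply/measurable_EFinP; exact: measurable_funD.
rewrite ge0_integralD//; last 2 first.
- by move=> z _; rewrite lee_fin sqr_ge0.
- exact/measurable_EFinP.
rewrite integral_sqr_normal integral_cst//.
rewrite [X in (X + 1)%E](_ : _ = 1%E); last first.
  by rewrite mul1e; exact: (probability_setT (normal_prob (0 : R) 1)).
rewrite -EFinD -!EFinM lee_fin; lra.
Qed.

End gauss_abs.

Lemma cvg_sum_fin {R : realType} (J : finType) (u : J -> nat -> R) (l : J -> R) :
  (forall j, u j n @[n --> \oo] --> l j) ->
  \sum_j u j n @[n --> \oo] --> \sum_j l j.
Proof.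
move=> ul; elim: (index_enum J) => [|j s IH].
  by rewrite big_nil; under eq_fun do rewrite big_nil; exact: cvg_cst.
rewrite big_cons; under eq_fun do rewrite big_cons.
by apply: cvgD; [exact: ul|exact: IH].
Qed.

Section gaussian_process.
Context {R : realType}.

(** The bound is a square because [a] will be squared coefficients: the standard deviation of a
    block, which controls its [L^1] norm, is the root of the block sum. *)
Lemma cvg_small_tail_index (a : nat -> R) (l : R) :
  (forall m, 0 <= a m) -> \sum_(m < n) a m @[n --> \oo] --> l ->
  exists M : nat -> nat, [/\ forall k, (k <= M k)%N,
    {homo M : m n / (m <= n)%N} &
    forall k, \sum_(M k <= m < M k.+1) a m <= (1 / (2 ^ (k + 1))%:R) ^+ 2].
Proof.
move=> a0 al.
have e0 k : 0 < (1 / (2 ^ (k + 1))%:R) ^+ 2 :> R.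
  by rewrite exprn_gt0// divr_gt0// ltr0n expn_gt0.
have /choice[N NE] : forall k, exists N, forall n, (N <= n)%N ->
    l - (1 / (2 ^ (k + 1))%:R) ^+ 2 <= \sum_(m < n) a m.
  move=> k; have : \forall n \near \oo, l - (1 / (2 ^ (k + 1))%:R) ^+ 2 <= \sum_(m < n) a m.
    by apply: (cvgr_ge _ al); rewrite gtrBl.
  by case=> N _ NE; exists N => n Nn; exact: NE.
(* Accumulating the [N j] makes [M] monotone with [N k <= M k]; the successors force [k <= M k]. *)
pose M k := (\sum_(j < k.+1) (N j).+1)%N.
have sumE n : \sum_(0 <= m < n) a m = \sum_(m < n) a m by rewrite big_mkord.
have nd : nondecreasing_seq (fun n => \sum_(m < n) a m).
  by apply/nondecreasing_seqP => n; rewrite big_ord_recr/= lerDl.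
have ub n : \sum_(m < n) a m <= l.
  rewrite -(cvg_lim _ al)//; apply: nondecreasing_cvgn_le => //; exact: cvgP al.
exists M; split.
- move=> k; rewrite /M; elim: k => // k IH; rewrite big_ord_recr/=.
  by rewrite addnS ltnS (leq_trans IH)// leq_addr.
- apply: homo_leq; [exact: leqnn|exact: leq_trans|] => k.
  by rewrite /M [leqRHS]big_ord_recr/= leq_addr.
- move=> k.
  have MM : (M k <= M k.+1)%N by rewrite /M [leqRHS]big_ord_recr/= leq_addr.
  have NM : (N k <= M k)%N.
    by rewrite /M big_ord_recr/= (leq_trans (leqnSn _))// leq_addl.
  have E : \sum_(m < M k.+1) a m = \sum_(m < M k) a m + \sum_(M k <= m < M k.+1) a m.
    by rewrite -!sumE (big_cat_nat (leq0n _) MM).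
  have := ub (M k.+1); have := NE k (M k) NM; rewrite E; lra.
Qed.

Variables (I : Type) (v : I -> nat -> R) (K : I -> I -> R).
Hypothesis vK : forall i j, \sum_(m < n) v i m * v j m @[n --> \oo] --> K i j.

(** The map [h] may repeat indices, so the same statement later covers single coordinates, sums of
    two coordinates (equal or not) and general linear forms. *)
Lemma exists_gaussian_process : exists2 X : I -> bits -> R,
  (forall i, measurable_fun setT (X i)) &
  forall (T : finType) (h : T -> I) (t : T -> R) (c : R),
    c ^+ 2 = \sum_i \sum_j t i * t j * K (h i) (h j) ->
    forall B, measurable B ->
    bitsP ((fun w => \sum_i t i * X (h i) w) @^-1` B) = gauss c B.
Proof.
have [g mg gE] := @exists_gaussian_sequence R.
have /choice[M MP] i := cvg_small_tail_index (fun m => sqr_ge0 (v i m)) (@vK i i).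
have Mge i k : (k <= M i k)%N by have [+ _ _] := MP i; exact.
have Mnd i : {homo M i : m n / (m <= n)%N} by have [_ + _] := MP i.
pose S i k w := \sum_(m < M i k) v i m * g m w.
have mS i k : measurable_fun setT (S i k).
  by apply: measurable_sum => m; apply: measurable_funM.
have /choice[X XP] i : exists Z : bits -> R, measurable_fun setT Z /\
    {ae @bitsP R, forall w, S i k w @[k --> \oo] --> Z w}.
  have [||Z mZ ZE] := @ae_cvg_of_summable_increments _ _ _ (@bitsP R) (S i).
  - exact: mS.
  - move=> k.
    (* Zeroing the coefficients below [M i k] gives the increment the shape required by [gE]. *)
    pose a m := if (m < M i k)%N then 0 else v i m.
    have SE w : S i k.+1 w - S i k w = \sum_(m < M i k.+1) a m * g m w.
      have MM := Mnd i _ _ (leqnSn k).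
      rewrite /S (big_ord_widen _ (fun m => v i m * g m w) MM) [X in _ - X]big_mkcond/=.
      rewrite -sumrB; apply: eq_bigr => m _; rewrite /a; case: ifP => _.
        by rewrite subrr mul0r.
      by rewrite subr0.
    have aE : \sum_(m < M i k.+1) a m ^+ 2 = \sum_(M i k <= m < M i k.+1) v i m ^+ 2.
      rewrite big_geq_mkord big_mkcond/= [RHS]big_mkcond/=; apply: eq_bigr => m _.
      rewrite /a ltnNge; case: leqP => //= _; by rewrite expr0n.
    under eq_integral do rewrite SE.
    apply: (@le_trans _ _ `|Num.sqrt (\sum_(m < M i k.+1) a m ^+ 2)|%:E).
      apply: integral_abs_gauss_le.
        by apply: measurable_sum => m; apply: measurable_funM.
      apply: gE; rewrite sqr_sqrtr//.
      by apply: sumr_ge0 => m _; exact: sqr_ge0.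
    rewrite lee_fin ger0_norm ?sqrtr_ge0// aE.
    have [_ _ /(_ k) h] := MP i.
    rewrite -[leRHS]ger0_norm ?divr_ge0// -sqrtr_sqr; exact: ler_wsqrtr.
  - by exists Z.
exists X; first by move=> i; have [] := XP i.
move=> T h t c cE.
(* A common upper bound for the finitely many cutoffs [M (h i) k]. *)
pose L k := (\sum_(i : T) M (h i) k)%N.
have ML i k : (M (h i) k <= L k)%N by rewrite /L (bigD1 i)//= leq_addr.
pose b k m := \sum_i t i * (if (m < M (h i) k)%N then v (h i) m else 0).
have SE k w : \sum_i t i * S (h i) k w = \sum_(m < L k) b k m * g m w.
  rewrite /b; under [RHS]eq_bigr do rewrite mulr_suml.
  rewrite exchange_big/=; apply: eq_bigr => i _.
  rewrite /S (big_ord_widen _ (fun m => v (h i) m * g m w) (ML i k)) [X in _ * X]big_mkcond/=.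
  rewrite mulr_sumr; apply: eq_bigr => m _; case: ifP => _; first by rewrite mulrA.
  by rewrite !mulr0 mul0r.
(* A mixed term retains only the ranks below both cutoffs, and the smaller cutoff is still at least
   [k]; so [vK] gives its limit. *)
have bE k : \sum_(m < L k) b k m ^+ 2 = \sum_i \sum_j t i * t j *
    (\sum_(m < minn (M (h i) k) (M (h j) k)) v (h i) m * v (h j) m).
  transitivity (\sum_(m < L k) \sum_i \sum_j t i * t j *
      (if (m < minn (M (h i) k) (M (h j) k))%N then v (h i) m * v (h j) m else 0)).
    apply: eq_bigr => m _; rewrite /b expr2 mulr_suml; apply: eq_bigr => i _.
    rewrite mulr_sumr; apply: eq_bigr => j _.
    rewrite mulrACA leq_min; congr (_ * _).
    by case: ifP => _ /=; [case: ifP => _ //; rewrite mulr0|rewrite mul0r].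
  rewrite exchange_big/=; apply: eq_bigr => i _.
  rewrite exchange_big/=; apply: eq_bigr => j _.
  rewrite -mulr_sumr -big_mkcond/= -(big_ord_widen _ (fun m => v (h i) m * v (h j) m))//.
  by rewrite (leq_trans (geq_minl _ _)).
pose s k := Num.sqrt (\sum_(m < L k) b k m ^+ 2).
(* The approximating standard deviations are nonnegative roots, so they tend to the absolute value
   of [c]. *)
move=> B mB; rewrite -(@gauss_sqr _ `|c| c)//; last by rewrite real_normK ?num_real.
move: B mB.
apply: (@gauss_limit _ _ _ _ (fun k w => \sum_i t i * S (h i) k w)
    (fun w => \sum_i t i * X (h i) w) s `|c|).
- move=> k; apply: measurable_sum => i; apply: measurable_funM => //; exact: mS.
- by apply: measurable_sum => i; apply: measurable_funM => //; have [] := XP (h i).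
- move=> k B mB.
  rewrite (_ : (fun w => _) = (fun w => \sum_(m < L k) b k m * g m w)); last first.
    by apply/funext => w; exact: SE.
  apply: gE => //; rewrite sqr_sqrtr//.
  by apply: sumr_ge0 => m _; exact: sqr_ge0.
- have : {ae @bitsP R, forall w, forall i : T, S (h i) k w @[k --> \oo] --> X (h i) w}.
    apply: filter_forall => i; by have [] := XP (h i).
  apply: filterS => w Sw; apply: cvg_sum_fin => i; apply: cvgMr; exact: Sw.
- rewrite -sqrtr_sqr cE; apply: (@cvg_comp _ _ _ _ Num.sqrt); last exact: sqrt_continuous.
  under eq_fun do rewrite bE.
  apply: cvg_sum_fin => i; apply: cvg_sum_fin => j; apply: cvgMr.
  apply: (@cvg_subseq_ge _ (fun n => \sum_(m < n) v (h i) m * v (h j) m)); last exact: vK.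
  by move=> k; rewrite leq_min !Mge.
Qed.

End gaussian_process.

(** * Feature maps of positive semidefinite kernels *)

Section schur_complement.
Context {R : realType} (I : Type).

(** Weighted lists, with repetitions allowed, can be extended by one point with a cons, which is how
    the Schur complement argument adds its pivot. *)
Definition psd_form (K : I -> I -> R) (s : seq (R * I)) : R :=
  \sum_(a <- s) \sum_(b <- s) a.1 * b.1 * K a.2 b.2.

Definition psd (K : I -> I -> R) : Prop :=
  (forall i j, K i j = K j i) /\ forall s, 0 <= psd_form K s.

Lemma psd_form_cons (K : I -> I -> R) (r : R) (p : I) s :
  (forall i j, K i j = K j i) ->
  psd_form K ((r, p) :: s) =
  r ^+ 2 * K p p + 2 * r * (\sum_(a <- s) a.1 * K a.2 p) + psd_form K s.
Proof.
move=> Ksym; rewrite /psd_form big_cons big_cons/=.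
under [X in _ + X]eq_bigr do rewrite big_cons/=.
pose S := \sum_(a <- s) a.1 * K a.2 p; rewrite -/S.
have E1 : \sum_(b <- s) r * b.1 * K p b.2 = r * S.
  by rewrite mulr_sumr; apply: eq_bigr => b _; rewrite Ksym mulrA.
have E2 : \sum_(a <- s) a.1 * r * K a.2 p = r * S.
  by rewrite mulr_sumr; apply: eq_bigr => a _; rewrite mulrA (mulrC r).
by rewrite big_split/= E1 E2; ring.
Qed.

Lemma psd_diag_ge0 (K : I -> I -> R) i : psd K -> 0 <= K i i.
Proof.
move=> [Ksym K0]; have := K0 [:: (1, i)].
by rewrite psd_form_cons// /psd_form !big_nil; rewrite mulr0 !addr0 expr1n mul1r.
Qed.

Lemma psd2 (K : I -> I -> R) i j (x y : R) : psd K ->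
  0 <= x ^+ 2 * K i i + 2 * x * y * K i j + y ^+ 2 * K j j.
Proof.
move=> [Ksym K0]; have := K0 [:: (x, i); (y, j)].
rewrite !psd_form_cons// /psd_form !(big_cons, big_nil)/= (Ksym j i).
by rewrite !mulr0 !addr0 mulrA.
Qed.

Lemma psd_null (K : I -> I -> R) i p : psd K -> K p p = 0 -> K i p = 0.
Proof.
move=> Kpsd Kp; apply/eqP/negPn/negP => Kip.
(* If [K i p] were nonzero, this weight at [p] would give the two-point form the value [-1]. *)
have := psd2 i p 1 (- (K i i + 1) / (2 * K i p)) Kpsd.
rewrite Kp mulr0 addr0 expr1n mul1r mulr1.
have -> : 2 * (- (K i i + 1) / (2 * K i p)) * K i p = - (K i i + 1).
  by field.
lra.
Qed.

(* When [K p p = 0] the division by zero leaves [K] unchanged, which is the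
   right Schur complement because then [K i p = 0] for every [i]. *)
Definition schur (K : I -> I -> R) (p : I) (i j : I) : R :=
  K i j - K i p * K p j / K p p.

Lemma psd_schur (K : I -> I -> R) (p : I) : psd K -> psd (schur K p).
Proof.
move=> Kpsd; have [Ksym K0] := Kpsd; split.
  by move=> i j; rewrite /schur (Ksym j i) (Ksym j p) (Ksym p i) [K p j * _]mulrC.
move=> s; pose L := \sum_(a <- s) a.1 * K a.2 p.
have -> : psd_form (schur K p) s = psd_form K s - L ^+ 2 / K p p.
  rewrite /psd_form expr2 {1}/L -mulrA mulr_suml -sumrB; apply: eq_bigr => a _.
  rewrite /L mulrA mulr_sumr mulr_suml -sumrB; apply: eq_bigr => b _.
  by rewrite /schur (Ksym p b.2); ring.
have [Kp|Kp] := eqVneq (K p p) 0; first by rewrite Kp invr0 mulr0 subr0.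
(* The weight at [p] that minimizes the form when the others are fixed; the minimum is the form of
   the Schur complement. *)
have := K0 ((- L / K p p, p) :: s); rewrite psd_form_cons// -/L.
suff -> : (- L / K p p) ^+ 2 * K p p + 2 * (- L / K p p) * L + psd_form K s =
  psd_form K s - L ^+ 2 / K p p by [].
by field.
Qed.

Lemma schur_pivot (K : I -> I -> R) (p : I) i : psd K -> schur K p i p = 0.
Proof.
move=> Kpsd; rewrite /schur; have [Kp|Kp] := eqVneq (K p p) 0.
  by rewrite (psd_null i Kpsd Kp) mul0r mul0r subrr.
by rewrite mulfK// subrr.
Qed.

(** The squared distance between the feature vectors of [i] and [j]. *)
Definition kernel_dist (K : I -> I -> R) (i j : I) : R := K i i + K j j - 2 * K i j.

(** A Schur complement projects the feature vectors onto the orthogonal of that of [p], and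
    projections contract distances. *)
Lemma kernel_dist_schur (K : I -> I -> R) (p i j : I) : psd K ->
  kernel_dist (schur K p) i j <= kernel_dist K i j.
Proof.
move=> Kpsd; have [Ksym K0] := Kpsd.
have -> : kernel_dist (schur K p) i j =
    kernel_dist K i j - (K i p - K j p) ^+ 2 / K p p.
  by rewrite /kernel_dist /schur (Ksym p i) (Ksym p j); ring.
by rewrite gerBl mulr_ge0 ?sqr_ge0// invr_ge0 psd_diag_ge0.
Qed.

Fixpoint schur_iter (K : I -> I -> R) (p : nat -> I) (n : nat) : I -> I -> R :=
  if n is m.+1 then schur (schur_iter K p m) (p m) else K.

Lemma psd_schur_iter K p n : psd K -> psd (schur_iter K p n).
Proof. by move=> Kpsd; elim: n => //= n IH; exact: psd_schur. Qed.

Lemma schur_iter_pivot K p m n i : psd K -> (n < m)%N ->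
  schur_iter K p m i (p n) = 0.
Proof.
move=> Kpsd; elim: m i => // m IH i; rewrite ltnS leq_eqVlt => /predU1P[->|nm] /=.
  by apply: schur_pivot; exact: psd_schur_iter.
by rewrite /schur !IH// mulr0 mul0r subrr.
Qed.

Lemma kernel_dist_schur_iter K p n i j : psd K ->
  kernel_dist (schur_iter K p n) i j <= kernel_dist K i j.
Proof.
move=> Kpsd; elim: n => //= n IH; apply: (le_trans _ IH).
by apply: kernel_dist_schur; exact: psd_schur_iter.
Qed.

(** The residual of [p n] is null from stage [n.+1] on, so the residual of [i] is its distance to
    [p n], and distances only decrease. *)
Lemma schur_iter_diag_le K p m n i : psd K -> (n < m)%N ->
  schur_iter K p m i i <= kernel_dist K i (p n).
Proof.
move=> Kpsd nm; apply: le_trans (kernel_dist_schur_iter p m i (p n) Kpsd).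
rewrite /kernel_dist !schur_iter_pivot//; lra.
Qed.

Lemma exists_feature_map (K : I -> I -> R) (p : nat -> I) : psd K ->
  (forall i e, 0 < e -> exists n, kernel_dist K i (p n) < e) ->
  exists v : I -> nat -> R,
    forall i j, \sum_(m < n) v i m * v j m @[n --> \oo] --> K i j.
Proof.
move=> Kpsd pdense; have Kn n := psd_schur_iter p n Kpsd.
pose k n := schur_iter K p n.
(* The coordinate of [i] along the [m]-th Gram-Schmidt vector. At a null pivot, division by zero
   makes it 0, in agreement with [schur]. *)
pose v i m := k m i (p m) / Num.sqrt (k m (p m) (p m)).
have vE i j n : \sum_(m < n) v i m * v j m = K i j - k n i j.
  elim: n => [|n IH]; first by rewrite big_ord0 subrr.
  rewrite big_ord_recr/= IH.
  rewrite -[k n.+1 i j]/(k n i j - k n i (p n) * k n (p n) j / k n (p n) (p n)).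
  have -> : v i n * v j n = k n i (p n) * k n (p n) j / k n (p n) (p n).
    have [Ksym _] := Kn n.
    by rewrite /v mulrACA -invfM -expr2 sqr_sqrtr ?psd_diag_ge0// /k [in RHS](Ksym (p n) j).
  by ring.
have diag0 i e : 0 < e -> \forall n \near \oo, k n i i < e.
  move=> e0; have [m me] := pdense i e e0; exists m.+1 => // n mn.
  by apply: le_lt_trans me; exact: schur_iter_diag_le.
exists v => i j; rewrite -[X in _ --> X]subr0.
under eq_fun do rewrite vE.
apply: cvgB; first exact: cvg_cst.
apply/cvgr0Pnorm_lt => e e0; near=> n.
have ki : k n i i < e by near: n; exact: diag0.
have kj : k n j j < e by near: n; exact: diag0.
(* The weights [(1, 1)] and [(1, -1)] bound the off-diagonal residual by the mean of the two
   diagonal ones. *)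
have := psd2 i j 1 1 (Kn n); have := psd2 i j 1 (-1) (Kn n).
rewrite -/(k n) ltr_norml; move: ki kj; set a := k n i i; set b := k n j j.
by move=> ki kj h1 h2; apply/andP; split; lra.
Unshelve. all: by end_near. Qed.

End schur_complement.

(** * The corner kernel *)

Section event_gram.
Context {R : realType} d (T : measurableType d) (P : probability T R).

(** The double sum is the expectation of the square of the weighted sum of indicators. *)
Lemma gram_events_ge0 (J : Type) (A : J -> set T) (s : seq (R * J)) :
  (forall j, measurable (A j)) ->
  0 <= \sum_(a <- s) \sum_(b <- s) a.1 * b.1 * fine (P (A a.2 `&` A b.2)).
Proof.
move=> mA.
have mI a b : measurable (A a `&` A b) by exact: measurableI.
have ind (a b : R * J) : (\int[P]_w (a.1 * b.1 * \1_(A a.2 `&` A b.2) w)%:E =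
    (a.1 * b.1 * fine (P (A a.2 `&` A b.2)))%:E)%E.
  under eq_integral do rewrite EFinM.
  rewrite integralZl//; last exact: integrable_indic.
  by rewrite integral_indic// setIT [RHS]EFinM fineK// fin_num_measure.
have intg (a b : R * J) :
    P.-integrable setT (fun w => (a.1 * b.1 * \1_(A a.2 `&` A b.2) w)%:E).
  under eq_fun do rewrite EFinM.
  by apply: integrableZl => //; exact: integrable_indic.
rewrite -lee_fin.
suff -> : (\sum_(a <- s) \sum_(b <- s) a.1 * b.1 * fine (P (A a.2 `&` A b.2)))%:E =
    (\int[P]_w ((\sum_(a <- s) a.1 * \1_(A a.2) w) ^+ 2)%:E)%E.
  by apply: integral_ge0 => w _; rewrite lee_fin sqr_ge0.
transitivity (\int[P]_w (\sum_(a <- s) \sum_(b <- s)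
    (a.1 * b.1 * \1_(A a.2 `&` A b.2) w)%:E))%E.
  rewrite integral_sum//; last by move=> a; exact: integrable_sum.
  rewrite -sumEFin; apply: eq_bigr => a _.
  rewrite integral_sum// -sumEFin; apply: eq_bigr => b _; exact/esym/ind.
apply: eq_integral => w _; rewrite expr2 mulr_suml -sumEFin; apply: eq_bigr => a _.
rewrite mulr_sumr -sumEFin; apply: eq_bigr => b _.
by rewrite indicI/= mulrACA.
Qed.
End event_gram.

(** * Boxes under the uniform law on the cube *)

Section uniform_cube_boxes.
Context {R : realType}.
Local Notation U := (@uniform01 R).

Definition tuple_box (d : nat) (B : 'I_d -> set R) : set (d.-tuple R) :=
  [set s | forall k, B k (tnth s k)].

Lemma measurable_tuple_box d (B : 'I_d -> set R) :
  (forall k, measurable (B k)) -> measurable (tuple_box B).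
Proof.
move=> mB; rewrite (_ : tuple_box B =
    \bigcap_(k in [set: 'I_d]) ((fun s : d.-tuple R => tnth s k) @^-1` B k)).
  apply: fin_bigcap_measurable => [|k _]; first exact: finite_finset.
  by apply: measurable_preim => //; exact: measurable_tnth.
by apply/seteqP; split => s /= sB k; [move=> _; exact: sB|exact: (sB k I)].
Qed.

Lemma P0_tuple_box d (B : 'I_d -> set R) : (forall k, measurable (B k)) ->
  P0 R d (tuple_box B) = (\prod_(k < d) fine (U (B k)))%:E.
Proof.
elim: d B => [|d IH] B mB.
  rewrite big_ord0 /= diracE mem_set//.
  by move=> [].
pose B' k := B (lift ord0 k).
rewrite big_ord_recl EFinM -(IH B'); last by move=> k; exact: mB.
transitivity ((U \x P0 R d)%E (B ord0 `*` tuple_box B')).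
  rewrite /= /distribution/= /pushforward/= /prod_prob; congr ((U \x P0 R d)%E _).
  apply/seteqP; split => -[x s] /=.
    move=> sB; split => [|k]; first exact: (sB ord0).
    by have := sB (lift ord0 k); rewrite tnthS.
  move=> [xB sB] k; case: (unliftP ord0 k) => [j ->|->]; last exact: xB.
  by rewrite tnthS; exact: sB.
have mB' : measurable (tuple_box B') by apply: measurable_tuple_box => k; exact: mB.
transitivity (U (B ord0) * P0 R d (tuple_box B'))%E.
  by apply: product_measure1E => //; exact: mB.
by congr (_ * _)%E; apply/esym/fineK/fin_num_measure; exact: mB.
Qed.

Definition corner_itv (b : bool) (x : R) : set R :=
  if b then `[x, 1]%classic else `[0, x]%classic.

Definition corner_side (b : bool) (x : R) : R := if b then 1 - x else x.

Lemma measurable_corner_itv b x : measurable (corner_itv b x).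
Proof. by case: b; exact: measurable_itv. Qed.

Lemma uniform01_corner_itv b x : 0 <= x <= 1 ->
  U (corner_itv b x) = (corner_side b x)%:E.
Proof.
move=> /andP[x0 x1]; rewrite uniform01_subset; last 2 first.
- case: b => t /=; rewrite !in_itv/= => /andP[h1 h2]; first by rewrite (le_trans x0).
  by rewrite h1 (le_trans h2).
- exact: measurable_corner_itv.
case: b; rewrite /corner_itv lebesgue_measure_itv/= lte_fin; case: ifPn => //.
- by rewrite -leNgt => h; rewrite (_ : x = 1) ?subrr//; apply/eqP; rewrite eq_le x1.
- by rewrite oppr0 adde0.
- by rewrite -leNgt => h; rewrite (_ : x = 0)//; apply/eqP; rewrite eq_le x0 h.
Qed.

Definition corner_meet (b : bool) (x y : R) : R :=
  if b then Num.max x y else Num.min x y.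

Lemma corner_itvI b x y :
  corner_itv b x `&` corner_itv b y = corner_itv b (corner_meet b x y).
Proof.
apply/seteqP; split => t; case: b => /=; rewrite !in_itv/=.
- by rewrite ge_max => -[/andP[-> ->] /andP[->]].
- by rewrite le_min => -[/andP[-> ->] /andP[_ ->]].
- by rewrite ge_max => /andP[/andP[-> ->] ->].
- by rewrite le_min => /andP[-> /andP[-> ->]].
Qed.

Lemma corner_meet01 b x y : 0 <= x <= 1 -> 0 <= y <= 1 ->
  0 <= corner_meet b x y <= 1.
Proof.
move=> /andP[x0 x1] /andP[y0 y1]; rewrite /corner_meet; case: b.
  by rewrite le_max x0 ge_max x1.
by rewrite le_min x0 y0 ge_min x1.
Qed.

Lemma corner_side_meet_dist b x y :
  `|corner_side b x - corner_side b (corner_meet b x y)| <= `|x - y|.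
Proof.
rewrite /corner_side /corner_meet; case: b; rewrite ?maxEle ?minEle.
  case: ifP => _; last by rewrite subrr normr0.
  rewrite (_ : 1 - x - (1 - y) = y - x); [by rewrite distrC|by ring].
by case: ifP => _; rewrite ?subrr ?normr0.
Qed.

Lemma corner_meetC b x y : corner_meet b x y = corner_meet b y x.
Proof. by case: b => /=; [rewrite maxC|rewrite minC]. Qed.

Lemma corner_side01 b x : 0 <= x <= 1 -> 0 <= corner_side b x <= 1.
Proof. by case: b => /= /andP[x0 x1]; apply/andP; split; lra. Qed.

(** The factors are exchanged one at a time, all the others lying in [[0, 1]]. *)
Lemma dist_prod_le (d : nat) (a b : 'I_d -> R) :
  (forall k, 0 <= a k <= 1) -> (forall k, 0 <= b k <= 1) ->
  `|\prod_(k < d) a k - \prod_(k < d) b k| <= \sum_(k < d) `|a k - b k|.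
Proof.
elim: d a b => [|d IH] a b a01 b01; first by rewrite !big_ord0 subrr normr0.
rewrite !big_ord_recl.
set A := \prod_(i < d) _; set B := \prod_(i < d) _.
have -> : a ord0 * A - b ord0 * B = a ord0 * (A - B) + (a ord0 - b ord0) * B by ring.
rewrite (le_trans (ler_normD _ _))// addrC lerD//.
  rewrite normrM ler_piMr// ger0_norm ?prodr_ge0// => [|i _].
    by apply: prodr_ile1 => i _.
  by have /andP[] := b01 (lift ord0 i).
have /andP[a0 a1] := a01 ord0.
rewrite normrM ger0_norm//; apply: (le_trans (ler_piMl _ a1)) => //.
exact: IH.
Qed.

End uniform_cube_boxes.

(** * Means and covariances read off one-dimensional laws *)

Section gauss_moments.
Context {R : realType} d (T : measurableType d) (P : probability T R).

Lemma integral_sqr_gauss (X : T -> R) (s : R) : measurable_fun setT X ->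
  (forall B, measurable B -> P (X @^-1` B) = gauss s B) ->
  (\int[P]_w (X w ^+ 2)%:E = (s ^+ 2)%:E)%E.
Proof.
move=> mX XE.
have ms : measurable_fun setT (fun y : measurableTypeR R => (y ^+ 2)%:E).
  exact/measurable_EFinP.
have := @ge0_integral_distribution _ _ _ _ _ P
  (@mfun_of _ _ _ (measurableTypeR R) X mX) (fun y => (y ^+ 2)%:E) ms (fun y => sqr_ge0 y).
move=> /= <-.
rewrite (eq_measure_integral (gauss s)); last by move=> A mA _; exact: XE.
rewrite integral_gauss//; last by move=> x; exact: sqr_ge0.
under eq_integral do rewrite exprMn EFinM.
rewrite ge0_integralZl_EFin ?sqr_ge0//.
- by rewrite integral_sqr_normal mule1.
- by move=> x _; rewrite lee_fin sqr_ge0.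
Qed.

Lemma integrable_sqr_gauss (X : T -> R) (s : R) : measurable_fun setT X ->
  (forall B, measurable B -> P (X @^-1` B) = gauss s B) ->
  P.-integrable setT (fun w => (X w ^+ 2)%:E).
Proof.
move=> mX XE; apply/integrableP; split.
  by apply/measurable_EFinP; exact: measurable_funX.
under eq_integral do rewrite abse_EFin ger0_norm ?sqr_ge0//.
by rewrite (integral_sqr_gauss mX XE) ltry.
Qed.

Lemma integrable_gauss (X : T -> R) (s : R) : measurable_fun setT X ->
  (forall B, measurable B -> P (X @^-1` B) = gauss s B) ->
  P.-integrable setT (EFin \o X).
Proof.
move=> mX XE; apply/integrableP; split; first exact/measurable_EFinP.
by apply: (le_lt_trans (integral_abs_gauss_le mX XE)); rewrite ltry.
Qed.

(** [X] and [- X] have the same law and are integrable, so the mean equals its opposite. *)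
Lemma integral_gauss_eq0 (X : T -> R) (s : R) : measurable_fun setT X ->
  (forall B, measurable B -> P (X @^-1` B) = gauss s B) ->
  (\int[P]_w (X w)%:E = 0)%E.
Proof.
move=> mX XE.
have iX := integrable_gauss mX XE.
have mN : measurable_fun setT (fun w => - X w) by exact: measurable_funN.
have NE B : measurable B -> P ((fun w => - X w) @^-1` B) = gauss s B.
  move=> mB.
  have mB' : measurable ((fun x : R => - x) @^-1` B).
    by apply: measurable_preim => //; exact: measurable_funN.
  rewrite -(gaussN s mB) gaussE.
  have := XE _ mB'; rewrite gaussE => XB.
  transitivity (P (X @^-1` ((fun x : R => - x) @^-1` B))); first by [].
  by rewrite XB; congr (normal_prob 0 1 _); apply/seteqP; split => z /=; rewrite mulNr.
have mE : measurable_fun setT (EFin : measurableTypeR R -> \bar R) by exact/measurable_EFinP.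
have intE (Y : T -> R) (mY : measurable_fun setT Y) :
    (forall B, measurable B -> P (Y @^-1` B) = gauss s B) ->
    P.-integrable setT (EFin \o Y) ->
    (\int[P]_w (Y w)%:E = \int[gauss s]_x x%:E)%E.
  move=> YE iY.
  have := @integral_distribution _ _ _ _ _ P
    (@mfun_of _ _ _ (measurableTypeR R) Y mY) EFin mE iY.
  by move=> /= <-; apply: eq_measure_integral => A mA _; exact: YE.
have := intE _ mN NE (integrable_gauss mN NE).
rewrite -(intE _ mX XE iX) => /eqP.
under eq_integral do rewrite EFinN.
rewrite integralN; last first.
  apply: fin_num_adde_defl; rewrite fin_numN.
  by apply: integrable_fin_num => //; exact: integrable_funeneg.
have : (\int[P]_w (X w)%:E)%E \is a fin_num by exact: integrable_fin_num.
case: (\int[P]_w (X w)%:E)%E => // r _; rewrite -EFinN eqe => /eqP rE.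
by congr EFin; lra.
Qed.

(* Polarization: covariances are read off the variances of sums. *)
Lemma covariance_gauss (X Y : T -> R) (s t c k : R) :
  measurable_fun setT X -> measurable_fun setT Y ->
  (forall B, measurable B -> P (X @^-1` B) = gauss s B) ->
  (forall B, measurable B -> P (Y @^-1` B) = gauss t B) ->
  (forall B, measurable B -> P ((fun w => X w + Y w) @^-1` B) = gauss c B) ->
  c ^+ 2 = s ^+ 2 + t ^+ 2 + 2 * k ->
  covariance P X Y = k%:E.
Proof.
move=> mX mY XE YE XYE cE.
have mXY : measurable_fun setT (fun w => X w + Y w) by exact: measurable_funD.
rewrite !unlock (integral_gauss_eq0 mX XE) (integral_gauss_eq0 mY YE)/=.
have iX := integrable_sqr_gauss mX XE.
have iY := integrable_sqr_gauss mY YE.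
have iXY := integrable_sqr_gauss mXY XYE.
transitivity (\int[P]_w (2^-1%:E * ((X w + Y w) ^+ 2 - X w ^+ 2 - Y w ^+ 2)%:E))%E.
  apply: eq_integral => w _; rewrite -EFinM; congr EFin.
  by rewrite /GRing.mul/= !subr0 -/(GRing.mul _ _); field.
have iB : P.-integrable setT (fun w => ((X w + Y w) ^+ 2 - X w ^+ 2)%:E).
  under eq_fun do rewrite EFinB.
  exact: integrableB.
rewrite integralZl//; last first.
  under eq_fun do rewrite EFinB.
  exact: integrableB.
under eq_integral do rewrite EFinB.
rewrite integralB//.
under eq_integral do rewrite EFinB.
rewrite integralB// (integral_sqr_gauss mX XE) (integral_sqr_gauss mY YE).
rewrite (integral_sqr_gauss mXY XYE) -!EFinB -EFinM cE; congr EFin; lra.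
Qed.

End gauss_moments.

Section corner_kernel.
Context {R : realType} {d : nat}.
Implicit Types (c : Corner d) (x y : d.-tuple R).

Lemma cornerLe_tuple_box c x : cube R d x ->
  cornerLe c x = tuple_box (fun k => corner_itv (c k) (tnth x k)).
Proof.
move=> x01; apply/seteqP; split => s.
  move=> [s01 sx] k; have := sx k; have /andP[s0 s1] := s01 k.
  by rewrite /corner_itv; case: (c k) => h /=; rewrite in_itv/= ?s0 ?s1 ?h.
move=> sB; split => k; have := sB k; have /andP[x0 x1] := x01 k;
  rewrite /corner_itv; case: (c k) => /=; rewrite in_itv/= => /andP[h1 h2] //.
- by rewrite (le_trans x0 h1) h2.
- by rewrite h1 (le_trans h2 x1).
Qed.

Lemma measurable_cornerLe c x : cube R d x -> measurable (cornerLe c x).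
Proof.
move=> x01; rewrite cornerLe_tuple_box//; apply: measurable_tuple_box => k.
exact: measurable_corner_itv.
Qed.

Lemma P0_cornerLe c x : cube R d x -> P0 R d (cornerLe c x) = (cornerF c x)%:E.
Proof.
move=> x01; rewrite cornerLe_tuple_box// P0_tuple_box; last first.
  by move=> k; exact: measurable_corner_itv.
by congr EFin; apply: eq_bigr => k _; rewrite uniform01_corner_itv//; exact: x01.
Qed.

Lemma P0_cornerLeI c x y : cube R d x -> cube R d y ->
  P0 R d (cornerLe c x `&` cornerLe c y) =
  (\prod_(k < d) corner_side (c k) (corner_meet (c k) (tnth x k) (tnth y k)))%:E.
Proof.
move=> x01 y01; rewrite !cornerLe_tuple_box//.
rewrite (_ : _ `&` _ =
    tuple_box (fun k => corner_itv (c k) (corner_meet (c k) (tnth x k) (tnth y k)))).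
  rewrite P0_tuple_box; last by move=> k; exact: measurable_corner_itv.
  congr EFin; apply: eq_bigr => k _; rewrite uniform01_corner_itv//.
  by apply: corner_meet01; [exact: x01|exact: y01].
apply/seteqP; split => s /=.
  by move=> [sx sy] k; rewrite -corner_itvI; split; [exact: sx|exact: sy].
by move=> sxy; split => k; have := sxy k; rewrite -corner_itvI => -[].
Qed.

Lemma cubeP (x : cube R d) : cube R d (val x).
Proof. exact: (set_mem (valP x)). Qed.

Definition corner_event (o : option (Idx R d)) : set (d.-tuple R) :=
  if o is Some j then cornerLe j.1 (val j.2) else setT.

Lemma measurable_corner_event o : measurable (corner_event o).
Proof. by case: o => [j|] //=; apply: measurable_cornerLe; exact: cubeP. Qed.

(* [Kd] is the Schur complement of the sure event in the Gram matrix of the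
   corner events, hence positive semidefinite. *)
Lemma psd_Kd : psd (@Kd R d).
Proof.
pose G o o' := fine (P0 R d (corner_event o `&` corner_event o')).
have psdG : psd G.
  split; first by move=> o o'; rewrite /G setIC.
  by move=> s; apply: gram_events_ge0; exact: measurable_corner_event.
have KE j l : Kd j l = schur G None (Some j) (Some l).
  rewrite /schur /G /= setIT setTI setIT probability_setT/= divr1.
  by rewrite !P0_cornerLe//; exact: cubeP.
have [Ssym S0] := psd_schur None psdG; split.
  by move=> j l; rewrite !KE Ssym.
move=> s; have := S0 [seq (a.1, Some a.2) | a <- s].
rewrite /psd_form big_map; congr (_ <= _); apply: eq_bigr => a _.
by rewrite big_map; apply: eq_bigr => b _; rewrite KE.
Qed.

(** The distance is the probability of the symmetric difference of the two corner sets minus the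
    squared difference of their probabilities. Comparing points with the same corner suffices, since
    there are finitely many corners. *)
Lemma kernel_dist_Kd_le c (x y : cube R d) :
  kernel_dist (@Kd R d) (c, x) (c, y) <=
  2 * \sum_(k < d) `|tnth (val x) k - tnth (val y) k|.
Proof.
have x01 := cubeP x; have y01 := cubeP y.
rewrite /kernel_dist /Kd/= !setIid !P0_cornerLe// P0_cornerLeI//=.
set m := \prod_(k < d) _.
have m01 k : 0 <= corner_side (c k) (corner_meet (c k) (tnth (val x) k) (tnth (val y) k)) <= 1.
  by apply: corner_side01; apply: corner_meet01; [exact: x01|exact: y01].
have s01 (z : cube R d) k : 0 <= corner_side (c k) (tnth (val z) k) <= 1.
  by apply: corner_side01; exact: cubeP.
have hx : `|cornerF c (val x) - m| <= \sum_(k < d) `|tnth (val x) k - tnth (val y) k|.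
  apply: (le_trans (dist_prod_le (s01 x) m01)).
  by apply: ler_sum => k _; exact: corner_side_meet_dist.
have hy : `|cornerF c (val y) - m| <= \sum_(k < d) `|tnth (val x) k - tnth (val y) k|.
  apply: (le_trans (dist_prod_le (s01 y) m01)).
  apply: ler_sum => k _; rewrite corner_meetC [leRHS]distrC.
  exact: corner_side_meet_dist.
move: (ler_normlW hx) (ler_normlW hy).
set F := cornerF c (val x); set F' := cornerF c (val y) => h1 h2.
have := sqr_ge0 (F - F'); rewrite expr2; nra.
Qed.

(** Rational approximations of a point on the boundary may leave the cube; clipping brings them back
    without moving them away from the point. *)
Definition clip (q : rat) : R := Num.max 0 (Num.min 1 (ratr q)).

Lemma clip01 q : 0 <= clip q <= 1.
Proof. by rewrite /clip le_max lexx ge_max ler01 ge_min lexx. Qed.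

Lemma clip_dist (x : R) q : 0 <= x <= 1 -> `|x - clip q| <= `|x - ratr q|.
Proof.
move=> /andP[x0 x1]; rewrite /clip minEle; case: ifP => [q1|/negbT].
  by rewrite (max_idPr ler01) !ler0_norm; lra.
rewrite -ltNge => q1; rewrite maxEle; case: ifP => // /negbT; rewrite -ltNge => q0.
by rewrite !ger0_norm; lra.
Qed.

Lemma cube_clip (q : d.-tuple rat) : map_tuple clip q \in cube R d.
Proof. by apply/mem_set => k; rewrite tnth_map clip01. Qed.

Definition rational_corner (q : Corner d * d.-tuple rat) : Idx R d :=
  (q.1, exist _ (map_tuple clip q.2) (cube_clip q.2)).

Lemma exists_dense_sequence : exists p : nat -> Idx R d,
  forall i e, 0 < e -> exists n, kernel_dist (@Kd R d) i (p n) < e.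
Proof.
(* Corners paired with rational tuples form a countable type; integers that code no pair get an
   arbitrary value. *)
exists (fun n : nat =>
  if (choice.unpickle n : option (Corner d * d.-tuple rat)) is Some q
  then rational_corner q
  else rational_corner ([ffun=> true], [tuple of nseq d 0])).
move=> [c x] e e0.
(* With error [e'] in each of the [d] coordinates the bound is [2 * d * e']; using [d.+1] makes it
   strictly smaller than [e]. *)
pose e' := e / (2 * d.+1%:R).
have e'0 : 0 < e' by rewrite divr_gt0// mulr_gt0.
have /choice[q qE] : forall k : 'I_d, exists q : rat, `|tnth (val x) k - ratr q| < e'.
  move=> k; have h : tnth (val x) k - e' < tnth (val x) k + e' by lra.
  have [q] := rat_in_itvoo h; rewrite in_itv/= => qk; exists q.
  by rewrite distrC ltr_distl.
exists (choice.pickle (c, [tuple q k | k < d])); rewrite choice.pickleK.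
apply: (le_lt_trans (kernel_dist_Kd_le _ _ _)) => /=.
apply: (@le_lt_trans _ _ (2 * \sum_(k < d) e')).
  rewrite ler_pM2l//; apply: ler_sum => k _.
  rewrite tnth_map tnth_mktuple; apply: le_trans (ltW (qE k)).
  exact/clip_dist/cubeP.
rewrite sumr_const card_ord -[e' *+ d]mulr_natr.
have : e' * (2 * d.+1%:R) = e by rewrite divfK// gt_eqF// mulr_gt0.
by rewrite -natr1; lra.
Qed.

End corner_kernel.

(** * The Gaussian measure *)

Section gaussian_field.
Context {R : realType} (I : Type) (X : I -> bits -> R).
Hypothesis mX : forall i, measurable_fun setT (X i).

Definition sample_path (w : bits) : prodR R I := fun i => X i w.

Lemma measurable_sample_path : measurable_fun setT sample_path.
Proof.
apply: (@measurability _ _ bits (prodR R I) setT sample_path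
  (@coord_cylinders R I) erefl).
move=> _ [_ [i [B [mB ->]]] <-]; rewrite setTI.
exact: (measurable_preim (mX i) mB).
Qed.

End gaussian_field.

Theorem theorem3p9 (R : realType) (d : nat) (hd : (1 <= d)%N) :
  exists mu : probability (prodR R (Idx R d)) R,
    forall A : {fset Idx R d},
      is_centered_gaussian (marginal mu A)
        (fun j l : A => Kd (val j) (val l)).
Proof.
have [p pdense] := @exists_dense_sequence R d.
have [v vK] := exists_feature_map (@psd_Kd R d) pdense.
have [X mX XE] := exists_gaussian_process vK.
exists (distribution (@bitsP R) (mfun_of (measurable_sample_path mX))) => A.
set P := marginal _ A.
(* All three clauses come from this law: [h] is the identity for linear forms, a map from [unit] for
   coordinates, and a map from [bool] for sums of two coordinates. *)
have lawP (T : finType) (h : T -> A) (t : T -> R) (c : R) :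
    c ^+ 2 = \sum_i \sum_j t i * t j * Kd (val (h i)) (val (h j)) ->
    forall B, measurable B ->
    P ((fun f : prodR R A => \sum_i t i * f (h i)) @^-1` B) = gauss c B.
  by move=> cE B mB; exact: (XE T (fun i => val (h i)) t c cE B mB).
have coordE (i : A) : forall B, measurable B ->
    P (Defs.coord i @^-1` B) = gauss (Num.sqrt (Kd (val i) (val i))) B.
  move=> B mB; rewrite -(lawP _ (fun _ : unit => i) (fun=> 1)) //.
    by congr (P (_ @^-1` B)); apply/funext => f; rewrite big_const card_unit/= mul1r addr0.
  rewrite !(big_const, card_unit)/= !addr0 !mul1r sqr_sqrtr//.
  exact: psd_diag_ge0 psd_Kd.
split.
- move=> t; pose c2 := \sum_i \sum_j t i * t j * Kd (val i) (val j).
  have c20 : 0 <= c2.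
    have := (@psd_Kd R d).2 [seq (t i, val i) | i <- index_enum A].
    rewrite /psd_form big_map; congr (_ <= _); apply: eq_bigr => i _.
    by rewrite big_map.
  exists 0, (Num.sqrt c2); split=> [|B mB]; first exact: sqrtr_ge0.
  rewrite -gauss_normal_law ?sqrtr_ge0//.
  by apply: (lawP _ id t) => //; rewrite sqr_sqrtr.
- move=> i; rewrite unlock.
  exact: (integral_gauss_eq0 (@measurable_coord R A i) (coordE i)).
- move=> i j; have [Ksym _] := @psd_Kd R d.
  (* The variance of the sum of the two coordinates, as the polarization in [covariance_gauss]
     requires. *)
  pose s := Kd (val i) (val i) + Kd (val j) (val j) + 2 * Kd (val i) (val j).
  have s0 : 0 <= s.
    by have := psd2 (val i) (val j) 1 1 (@psd_Kd R d); rewrite /s; lra.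
  apply: (@covariance_gauss _ _ _ P _ _ _ _ (Num.sqrt s) _ _ _ (coordE i) (coordE j)).
  + exact: measurable_coord.
  + exact: measurable_coord.
  + move=> B mB.
    rewrite -(lawP _ (fun b : bool => if b then i else j) (fun=> 1))//.
      by congr (P (_ @^-1` B)); apply/funext => f; rewrite big_bool /= !mul1r.
    by rewrite sqr_sqrtr// !big_bool/= !mul1r (Ksym (val j) (val i)) /s; ring.
  + by rewrite !sqr_sqrtr//; apply: psd_diag_ge0; exact: psd_Kd.
Qed.
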